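(* Let $\mathbf{k}$ be a commutative ring and let $G$ be a flat affine group scheme over $\mathbf{k}$. If $G$ is power reductive over $\mathbf{k}$, then $G$ is geometrically reductive over $\mathbf{k}$.
   Context: $G$ is not assumed algebraic. A $G$-module is a $\mathbf{k}$-module with a comodule structure over the Hopf algebra $\mathbf{k}[G]$; $M^G$ denotes the invariants of a $G$-module $M$, and $\mathbf{k}$ is a $G$-module with trivial action. $S^d$ denotes the $d$-th symmetric power over $\mathbf{k}$. For a $G$-module $M$ that is finitely generated projective over $\mathbf{k}$, $M^\vee=\mathrm{Hom}_{\mathbf{k}}(M,\mathbf{k})$ with its $G$-module structure. Power reductivity: $G$ is power reductive over $\mathbf{k}$ if for every surjective map of $G$-modules $\varphi:M\to\mathbf{k}$ there is a positive integer $d$ such that $S^d\varphi:S^dM\to S^d\mathbf{k}$ is a split surjection of $G$-modules, i.e. the kernel of $S^d\varphi$ has a $G$-stable complement in $S^dM$. Geometric reductivity when $\mathbf{k}$ is a field: for every injective map $\varphi:\mathbf{k}\to M$ of finite dimensional $G$-modules there is a positive integer $d$ such that the restriction map $S^d(M^\vee)^G\to S^d(\mathbf{k}^\vee)$ is nonzero. Geometric reductivity when $\mathbf{k}$ is not a field: for every $G$-module $M$ that is finitely generated and free as a $\mathbf{k}$-module, every field $F$ that is also a $\mathbf{k}$-algebra (with trivial $G$-action on $F$), and every nonzero invariant vector $v\in(F\otimes_{\mathbf{k}}M)^G$, there is a positive integer $d$ such that the evaluation map at $v$, $S^d(M^\vee)^G\to F$, $f\mapsto f(v)$ (elements of $S^d(M^\vee)$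 being regarded as homogeneous polynomials of degree $d$ on $M$, evaluated at $v$ after base change to $F$), is nonzero. *)

(* Defs.v *)
From HB Require Import structures.
From mathcomp Require Import all_boot all_algebra.
From mathcomp Require Import boolp classical_sets functions.

Set Implicit Arguments.
Unset Strict Implicit.
Unset Printing Implicit Defensive.

Import GRing.Theory.
Local Open Scope ring_scope.
Local Open Scope quotient_scope.

(* A commutative algebra over [k] is a commutative ring [A] together with a    *)
(* ring morphism [k -> A]; [a *: x] is the product of [x] with the image of   *)
(* [a].  MathComp's [comAlgType] is not used because it excludes the zero     *)
(* ring, whereas [k] is an arbitrary commutative ring here.                   *)
Record comAlg (k : comPzRingType) := ComAlg {
  alg_ring : comPzRingType;
  alg_map : {rmorphism k -> alg_ring}
}.

Definition alg (k : comPzRingType) (A : comAlg k) : Type := alg_ring A.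
Coercion alg : comAlg >-> Sortclass.

Section AlgModule.
Variables (k : comPzRingType) (A : comAlg k).
HB.instance Definition _ := GRing.ComPzRing.copy (alg A) (alg_ring A).

Definition alg_scale (a : k) (x : alg A) : alg A := alg_map A a * x.

Fact alg_scaleA a b x : alg_scale a (alg_scale b x) = alg_scale (a * b) x.
Proof. by rewrite /alg_scale rmorphM mulrA. Qed.
Fact alg_scale1 : left_id 1 alg_scale.
Proof. by move=> x; rewrite /alg_scale rmorph1 mul1r. Qed.
Fact alg_scaleDr : right_distributive alg_scale +%R.
Proof. by move=> a x y; rewrite /alg_scale mulrDr. Qed.
Fact alg_scaleDl x : {morph alg_scale^~ x : a b / a + b}.
Proof. by move=> a b; rewrite /alg_scale rmorphD mulrDl. Qed.
HB.instance Definition _ := GRing.Zmodule_isLmodule.Build k (alg A)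
  alg_scaleA alg_scale1 alg_scaleDr alg_scaleDl.

Lemma alg_scaleAl (a : k) (x y : alg A) : a *: (x * y) = (a *: x) * y.
Proof. exact: mulrA. Qed.
Lemma alg_scaleAr (a : k) (x y : alg A) : a *: (x * y) = x * (a *: y).
Proof. exact: mulrCA. Qed.
End AlgModule.

Definition is_field (K : comPzRingType) : Prop :=
  (1 != 0 :> K) /\ (forall x : K, x != 0 -> exists y, x * y = 1).

(* The module receiving the universal map among the maps [X -> P] of a given  *)
(* class [C]: formal linear combinations of elements of [X], two of them      *)
(* being identified when every map of class [C] takes the same value on both. *)
(* It is used with [C] = bilinear maps on [M * N] (tensor product) and [C] =  *)
(* symmetric multilinear maps on [d.-tuple M] (symmetric power); in both      *)
(* cases [ugen] is itself of class [C], so that [ulift] and [umod_ext] are    *)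
(* the usual universal property.                                              *)
Section Universal.
Variables (k : comPzRingType) (X : choiceType).
Variable C : forall P : lmodType k, (X -> P) -> Prop.

Definition lincomb (P : lmodType k) (g : X -> P) (s : seq (k * X)) : P :=
  \sum_(p <- s) p.1 *: g p.2.

Definition ueq (s t : seq (k * X)) : bool :=
  `[< forall (P : lmodType k) (g : X -> P), C g -> lincomb g s = lincomb g t >].

Lemma ueq_refl : reflexive ueq.
Proof. by move=> s; apply/asboolP. Qed.
Lemma ueq_sym : symmetric ueq.
Proof. by move=> s t; apply/asbool_equiv_eq; split=> h P g /h. Qed.
Lemma ueq_trans : transitive ueq.
Proof.
by move=> s t u /asboolP h /asboolP h'; apply/asboolP=> P g Cg; rewrite h ?h'.
Qed.
Canonical ueq_equiv := EquivRel ueq ueq_refl ueq_sym ueq_trans.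

Definition umod := {eq_quot ueq_equiv}.
HB.instance Definition _ := Choice.on umod.

Definition umk (s : seq (k * X)) : umod := \pi_umod s.
Definition ulift_fun (P : lmodType k) (g : X -> P) (u : umod) : P :=
  lincomb g (repr u).

Lemma umkE (P : lmodType k) (g : X -> P) s :
  C g -> ulift_fun g (umk s) = lincomb g s.
Proof.
move=> Cg; rewrite /ulift_fun.
have /eqquotP/asboolP -> // : repr (umk s) = s %[mod umod] by rewrite reprK.
Qed.

Lemma umod_inj (u v : umod) :
  (forall (P : lmodType k) (g : X -> P), C g -> ulift_fun g u = ulift_fun g v) ->
  u = v.
Proof.
move=> h; rewrite -[u]reprK -[v]reprK; apply/eqquotP/asboolP; exact: h.
Qed.

Definition scale_comb (a : k) (s : seq (k * X)) := [seq (a * p.1, p.2) | p <- s].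

Lemma lincomb_cat (P : lmodType k) (g : X -> P) s t :
  lincomb g (s ++ t) = lincomb g s + lincomb g t.
Proof. exact: big_cat. Qed.

Lemma lincomb_scale (P : lmodType k) (g : X -> P) a s :
  lincomb g (scale_comb a s) = a *: lincomb g s.
Proof.
rewrite /lincomb big_map scaler_sumr; apply: eq_bigr => p _.
by rewrite scalerA.
Qed.

Definition uadd (u v : umod) := umk (repr u ++ repr v).
Definition uzero := umk [::].
Definition uscale a (u : umod) := umk (scale_comb a (repr u)).
Definition uopp (u : umod) := uscale (-1) u.

Section Ulift.
Variables (P : lmodType k) (g : X -> P) (Cg : C g).
Lemma uliftD u v : ulift_fun g (uadd u v) = ulift_fun g u + ulift_fun g v.
Proof. by rewrite umkE // lincomb_cat. Qed.
Lemma ulift0 : ulift_fun g uzero = 0.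
Proof. by rewrite umkE // /lincomb big_nil. Qed.
Lemma uliftZ a u : ulift_fun g (uscale a u) = a *: ulift_fun g u.
Proof. by rewrite umkE // lincomb_scale. Qed.
End Ulift.

Fact uaddA : associative uadd.
Proof. by move=> u v w; apply: umod_inj => P g Cg; rewrite !uliftD // addrA. Qed.
Fact uaddC : commutative uadd.
Proof. by move=> u v; apply: umod_inj => P g Cg; rewrite !uliftD // addrC. Qed.
Fact uadd0 : left_id uzero uadd.
Proof. by move=> u; apply: umod_inj => P g Cg; rewrite uliftD // ulift0 // add0r. Qed.
Fact uaddN : left_inverse uzero uopp uadd.
Proof.
move=> u; apply: umod_inj => P g Cg.
by rewrite uliftD // uliftZ // ulift0 // scaleN1r addNr.
Qed.
HB.instance Definition _ := GRing.isZmodule.Build umod uaddA uaddC uadd0 uaddN.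

Fact uscaleA a b u : uscale a (uscale b u) = uscale (a * b) u.
Proof. by apply: umod_inj => P g Cg; rewrite !uliftZ // scalerA. Qed.
Fact uscale1 : left_id 1 uscale.
Proof. by move=> u; apply: umod_inj => P g Cg; rewrite uliftZ // scale1r. Qed.
Fact uscaleDr : right_distributive uscale +%R.
Proof.
move=> a u v; apply: umod_inj => P g Cg.
by rewrite uliftZ // !uliftD // !uliftZ // scalerDr.
Qed.
Fact uscaleDl u : {morph uscale^~ u : a b / a + b}.
Proof.
move=> a b; apply: umod_inj => P g Cg.
by rewrite uliftZ // uliftD // !uliftZ // scalerDl.
Qed.
HB.instance Definition _ :=
  GRing.Zmodule_isLmodule.Build k umod uscaleA uscale1 uscaleDr uscaleDl.

Lemma ulift_linear (P : lmodType k) (g : X -> P) : C g -> linear (ulift_fun g).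
Proof. by move=> Cg a u v; rewrite uliftD // uliftZ. Qed.

Definition ulift (P : lmodType k) (g : X -> P) (Cg : C g) : {linear umod -> P} :=
  HB.pack (ulift_fun g) (GRing.isLinear.Build k umod P _ _ (ulift_linear Cg)).

Definition ugen (x : X) : umod := umk [:: (1, x)].

Lemma uliftE (P : lmodType k) (g : X -> P) (Cg : C g) x :
  ulift Cg (ugen x) = g x.
Proof. by rewrite /= umkE // /lincomb big_seq1 scale1r. Qed.

Lemma umod_gen (u : umod) : u = \sum_(p <- repr u) p.1 *: ugen p.2.
Proof.
apply: umod_inj => P g Cg; pose h := ulift Cg.
rewrite -[LHS]/(\sum_(p <- repr u) p.1 *: g p.2) -[RHS]/(h _) linear_sum.
by apply: eq_bigr => p _; rewrite linearZ uliftE.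
Qed.

Lemma umod_ext (P : lmodType k) (f g : {linear umod -> P}) :
  (forall x, f (ugen x) = g (ugen x)) -> f =1 g.
Proof.
move=> fg u; rewrite [u]umod_gen !linear_sum; apply: eq_bigr => p _.
by rewrite !linearZ fg.
Qed.
End Universal.

Section LinearPacking.
Variables (k : comPzRingType) (M N : lmodType k).
Definition lin_of (f : M -> N) (lf : linear f) : {linear M -> N} :=
  HB.pack f (GRing.isLinear.Build k M N _ f lf).
Lemma linD (f : {linear M -> N}) x y : f (x + y) = f x + f y.
Proof. exact: raddfD. Qed.
Lemma linZ (f : {linear M -> N}) a x : f (a *: x) = a *: f x.
Proof. exact: linearZZ. Qed.
End LinearPacking.

Record bilmap (k : comPzRingType) (M N P : lmodType k) := Bilmap {
  bil_fun :> M -> N -> P;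
  bil_l : forall y, linear (bil_fun^~ y);
  bil_r : forall x, linear (bil_fun x)
}.

Section BilTheory.
Variables (k : comPzRingType) (M N P : lmodType k) (b : bilmap M N P).
Lemma bilDl x x' y : b (x + x') y = b x y + b x' y.
Proof. exact: (linD (lin_of (bil_l b y))). Qed.
Lemma bilDr x y y' : b x (y + y') = b x y + b x y'.
Proof. exact: (linD (lin_of (bil_r b x))). Qed.
Lemma bilZl a x y : b (a *: x) y = a *: b x y.
Proof. exact: (linearZZ (lin_of (bil_l b y))). Qed.
Lemma bilZr a x y : b x (a *: y) = a *: b x y.
Proof. exact: (linearZZ (lin_of (bil_r b x))). Qed.
End BilTheory.

Section Tensor.
Variables (k : comPzRingType) (M N : lmodType k).

Definition tensor_class (P : lmodType k) (g : M * N -> P) : Prop :=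
  (forall y, linear (fun x => g (x, y))) /\ (forall x, linear (fun y => g (x, y))).

Definition tens : Type := umod tensor_class.
HB.instance Definition _ := GRing.Lmodule.on tens.

Definition ten (x : M) (y : N) : tens := ugen tensor_class (x, y).

Fact ten_l y : linear (ten^~ y).
Proof.
move=> a x x'; apply: umod_inj => P g Cg; rewrite -![ulift_fun g _]/(ulift Cg _).
by rewrite linearP !uliftE; case: Cg => gl _; apply: gl.
Qed.
Fact ten_r x : linear (ten x).
Proof.
move=> a y y'; apply: umod_inj => P g Cg; rewrite -![ulift_fun g _]/(ulift Cg _).
by rewrite linearP !uliftE; case: Cg => _ gr; apply: gr.
Qed.
Definition ten_bil : bilmap M N tens := Bilmap ten_l ten_r.

Section Lift.
Variables (P : lmodType k) (b : bilmap M N P).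
Fact tlift_subproof : tensor_class (fun p => b p.1 p.2).
Proof. by split=> [y|x]; [apply: bil_l | apply: bil_r]. Qed.
Definition tlift : {linear tens -> P} := ulift tlift_subproof.
Lemma tliftE x y : tlift (ten x y) = b x y.
Proof. exact: uliftE. Qed.
End Lift.

Lemma tens_sum (u : tens) :
  exists s : seq (M * N), u = \sum_(p <- s) ten p.1 p.2.
Proof.
exists [seq (p.1 *: p.2.1, p.2.2) | p <- repr (u : umod _)].
rewrite big_map [LHS]umod_gen; apply: eq_bigr => -[a [x y]] _ /=.
by rewrite -[RHS]/(ten_bil _ _) bilZl.
Qed.

Lemma tens_ind (Q : tens -> Prop) : (forall x y, Q (ten x y)) ->
  (forall u v, Q u -> Q v -> Q (u + v)) -> forall u, Q u.
Proof.
move=> Qt QD u; have [s ->] := tens_sum u.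
elim: s => [|p s IH]; last by rewrite big_cons; apply: QD.
rewrite big_nil; suff -> : 0 = ten 0 0 by [].
by rewrite -[ten 0 0]/(ten_bil 0 0) -[X in ten_bil X](scale0r 0) bilZl scale0r.
Qed.

Lemma tens_ext (P : lmodType k) (f g : {linear tens -> P}) :
  (forall x y, f (ten x y) = g (ten x y)) -> f =1 g.
Proof. by move=> fg; elim/tens_ind => // u v hu hv; rewrite !linD hu hv. Qed.
End Tensor.

Notation "x *t y" := (ten x y) (at level 40, left associativity) : ring_scope.

Section TensorMaps.
Variable k : comPzRingType.
Implicit Types M N P : lmodType k.

Fact tmap_l M N M' N' (f : {linear M -> M'}) (g : {linear N -> N'}) y :
  linear (fun x => f x *t g y).
Proof. by move=> a x x'; rewrite linearP; apply: ten_l. Qed.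
Fact tmap_r M N M' N' (f : {linear M -> M'}) (g : {linear N -> N'}) x :
  linear (fun y => f x *t g y).
Proof. by move=> a y y'; rewrite linearP; apply: ten_r. Qed.
Definition tmap M N M' N' (f : {linear M -> M'}) (g : {linear N -> N'}) :
  {linear tens M N -> tens M' N'} := tlift (Bilmap (tmap_l f g) (tmap_r f g)).
Lemma tmapE M N M' N' (f : {linear M -> M'}) (g : {linear N -> N'}) x y :
  tmap f g (x *t y) = f x *t g y.
Proof. exact: tliftE. Qed.

Definition flat (A : lmodType k) : Prop :=
  forall M N (f : {linear M -> N}), injective f ->
  injective (tmap f (idfun : {linear A -> A})).

(* The product [(x *t a) * (y *t a') = b x y *t c a a'] induced by [b], [c]. *)
Section Tmul.
Variables M N P A A' B : lmodType k.
Variables (b : bilmap M N P) (c : bilmap A A' B).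

Fact tmul1_l x a a' : linear (fun y => b x y *t c a a').
Proof. by move=> e y y'; rewrite bil_r; apply: ten_l. Qed.
Fact tmul1_r x a y : linear (fun a' => b x y *t c a a').
Proof. by move=> e a' a''; rewrite bil_r; apply: ten_r. Qed.
Definition tmul1 x a : {linear tens N A' -> tens P B} :=
  tlift (Bilmap (tmul1_l x a) (tmul1_r x a)).

Lemma tmul1E x a y a' : tmul1 x a (y *t a') = b x y *t c a a'.
Proof. exact: tliftE. Qed.

Fact tmul2_l v a : linear (fun x => tmul1 x a v).
Proof.
move=> e x x'; elim/tens_ind: v => [y a'|u v hu hv].
  by rewrite !tmul1E bil_l; apply: ten_l.
by rewrite !linD hu hv /= ?scalerDr addrACA.
Qed.
Fact tmul2_r v x : linear (fun a => tmul1 x a v).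
Proof.
move=> e a a'; elim/tens_ind: v => [y a''|u v hu hv].
  by rewrite !tmul1E bil_l; apply: ten_r.
by rewrite !linD hu hv /= ?scalerDr addrACA.
Qed.
Definition tmul_fun (u : tens M A) (v : tens N A') : tens P B :=
  tlift (Bilmap (tmul2_l v) (tmul2_r v)) u.

Lemma tmul_funE x a y a' : tmul_fun (x *t a) (y *t a') = b x y *t c a a'.
Proof. by rewrite /tmul_fun tliftE; apply: tmul1E. Qed.

Fact tmul_l v : linear (tmul_fun^~ v).
Proof. by move=> e u u'; apply: linearP. Qed.
Fact tmul_r u : linear (tmul_fun u).
Proof.
move=> e v v'; elim/tens_ind: u => [x a|u u' hu hu'].
  by rewrite /tmul_fun !tliftE; apply: linearP.
have D w := linD (lin_of (tmul_l w)) u u'; rewrite /= in D.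
by rewrite !D hu hu' ?scalerDr addrACA.
Qed.
Definition tmul : bilmap (tens M A) (tens N A') (tens P B) := Bilmap tmul_l tmul_r.

Lemma tmulE x a y a' : tmul (x *t a) (y *t a') = b x y *t c a a'.
Proof. exact: tmul_funE. Qed.
End Tmul.

Fact alg_mul_l (A : comAlg k) (y : A) : linear (fun x : A => x * y).
Proof. by move=> a x x'; rewrite mulrDl alg_scaleAl. Qed.
Fact alg_mul_r (A : comAlg k) (x : A) : linear (fun y : A => x * y).
Proof. by move=> a y y'; rewrite mulrDr alg_scaleAr. Qed.
Definition alg_mul (A : comAlg k) : bilmap A A A :=
  Bilmap (@alg_mul_l A) (@alg_mul_r A).

Section Assoc.
Variables M N P : lmodType k.
Definition tassoc1 (z : P) : {linear tens M N -> tens M (tens N P)} :=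
  tmap idfun (lin_of (bil_l (ten_bil N P) z)).
Fact tassoc_r (u : tens M N) : linear (fun z => tassoc1 z u).
Proof.
move=> a z z'; elim/tens_ind: u => [x y|u v hu hv].
  by rewrite !tmapE /= [y *t _]ten_r; apply: ten_r.
by rewrite !linD hu hv /= ?scalerDr addrACA.
Qed.
Definition tassoc : {linear tens (tens M N) P -> tens M (tens N P)} :=
  tlift (Bilmap (fun z => linearP (tassoc1 z)) tassoc_r).
Lemma tassocE x y z : tassoc (x *t y *t z) = x *t (y *t z).
Proof. by rewrite tliftE; apply: tmapE. Qed.
End Assoc.

(* Contraction of the algebra factor along a linear form: x *t a |-> f a *: x *)
Section Contract.
Variables (M A : lmodType k) (f : {linear A -> k^o}).
Fact tcontract_l a : linear (fun x : M => (f a : k) *: x).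
Proof. by move=> e x x'; rewrite scalerDr !scalerA mulrC. Qed.
Fact tcontract_r (x : M) : linear (fun a => (f a : k) *: x).
Proof. by move=> e a a'; rewrite linearP scalerDl scalerA. Qed.
Definition tcontract : {linear tens M A -> M} :=
  tlift (Bilmap tcontract_l tcontract_r).
Lemma tcontractE x a : tcontract (x *t a) = (f a : k) *: x.
Proof. exact: tliftE. Qed.
End Contract.
End TensorMaps.
Section SymmetricPower.
Variables (k : comPzRingType) (M : lmodType k).

Definition tset (T : Type) d (t : d.-tuple T) (i : 'I_d) (x : T) : d.-tuple T :=
  [tuple if j == i then x else tnth t j | j < d].

Definition symmetric_multilinear d (P : lmodType k) (g : d.-tuple M -> P) : Prop :=
  (forall t t' : d.-tuple M, perm_eq t t' -> g t = g t') /\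
  (forall t i, linear (fun x => g (tset t i x))).

Definition Sym d : Type := umod (@symmetric_multilinear d).
HB.instance Definition _ d := GRing.Lmodule.on (Sym d).

Definition mon d (t : d.-tuple M) : Sym d := ugen (@symmetric_multilinear d) t.

Lemma mon_sml d : symmetric_multilinear (@mon d).
Proof.
split=> [t t' tt'|t i a x x']; apply: umod_inj => P g Cg;
  rewrite -![ulift_fun g _]/(ulift Cg _) ?linearP !uliftE; case: Cg => gs gl.
  exact: gs.
exact: gl.
Qed.

Definition slift d (P : lmodType k) (g : d.-tuple M -> P)
  (Cg : symmetric_multilinear g) : {linear Sym d -> P} := ulift Cg.
Lemma sliftE d (P : lmodType k) (g : d.-tuple M -> P)
  (Cg : symmetric_multilinear g) t : slift Cg (mon t) = g t.
Proof. exact: uliftE. Qed.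

Lemma Sym_ext d (P : lmodType k) (f g : {linear Sym d -> P}) :
  (forall t, f (mon t) = g (mon t)) -> f =1 g.
Proof. exact: umod_ext. Qed.

Lemma Sym_ind d (Q : Sym d -> Prop) : Q 0 ->
  (forall a t u, Q u -> Q (a *: mon t + u)) -> forall u, Q u.
Proof.
move=> Q0 QD u; rewrite [u]umod_gen; elim: (repr _) => [|p s IH].
  by rewrite big_nil.
by rewrite big_cons; apply: QD.
Qed.

Fact sml_behead d (P : lmodType k) (g : d.+1.-tuple M -> P) x :
  symmetric_multilinear g -> symmetric_multilinear (fun t => g [tuple of x :: t]).
Proof.
case=> gs gl; split=> [t t' tt'|t i a y y']; first by apply: gs; rewrite /= perm_cons.
have E z : [tuple of x :: tset t i z] = tset [tuple of x :: t] (lift ord0 i) z.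
  apply: eq_from_tnth => j; rewrite tnth_mktuple.
  case: (unliftP ord0 j) => [j' ->|->]; last by rewrite !tnth0.
  by rewrite !tnthS tnth_mktuple (inj_eq lift_inj).
by rewrite !E; apply: gl.
Qed.
End SymmetricPower.

Section SymFold.
Variables (k : comPzRingType) (T : lmodType k) (Y : nat -> lmodType k).
Variables (op : forall n, bilmap T (Y n) (Y n.+1)) (y0 : Y 0).
Hypothesis opC : forall n x y z, op n.+1 x (op n y z) = op n.+1 y (op n x z).

Fixpoint sfold n : n.-tuple T -> Y n :=
  match n with
  | 0 => fun=> y0
  | n'.+1 => fun t => op n' (thead t) (sfold (behead_tuple t))
  end.

Lemma sfold_cons n z (v : n.-tuple T) :
  sfold [tuple of z :: v] = op n z (sfold v).
Proof. by rewrite /= theadE; congr (op n z (sfold _)); apply: val_inj. Qed.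

Fact sfold_sml n : symmetric_multilinear (@sfold n).
Proof.
elim: n => [|n [IHp IHl]].
  by split=> [//|t []].
split=> [t t'|t i].
  case/tupleP: t => x w; case/tupleP: t' => y w' tt'.
  rewrite !sfold_cons; have [xy|xy] := eqVneq x y.
    rewrite xy in tt' *; congr (op n y _); apply: IHp.
    by rewrite /= perm_cons in tt'.
  have yw : y \in (w : seq T).
    have : y \in x :: w by rewrite (perm_mem tt') mem_head.
    by rewrite inE eq_sym (negPf xy).
  case: n w w' IHp {IHl} yw tt' => [|n] w w' IHp yw tt'.
    by rewrite tuple0 in yw.
  have sz : size (rem y w) == n by rewrite size_rem // size_tuple.
  pose u := Tuple sz.
  have wu : perm_eq w [tuple of y :: u] by apply: perm_to_rem.
  have w'u : perm_eq w' [tuple of x :: u].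
    rewrite -(perm_cons y); rewrite perm_sym in tt'.
    apply: (perm_trans tt'); rewrite /= -[y :: x :: _]/([:: y] ++ [:: x] ++ rem y w).
    by rewrite perm_sym perm_catCA /= perm_cons perm_sym.
  by rewrite (IHp _ _ wu) (IHp _ _ w'u) !sfold_cons opC.
have H1 x (j : 'I_n) : thead (tset t (lift ord0 j) x) = thead t.
  by rewrite /thead tnth_mktuple.
have H0 x : thead (tset t ord0 x) = x by rewrite /thead tnth_mktuple.
have B0 x : behead_tuple (tset t ord0 x) = behead_tuple t.
  apply: eq_from_tnth => j; rewrite !tnth_behead tnth_mktuple.
  by case: eqP => // /(congr1 val); rewrite /= inordK // ltnS ltn_ord.
have B1 x (j : 'I_n) :
    behead_tuple (tset t (lift ord0 j) x) = tset (behead_tuple t) j x.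
  apply: eq_from_tnth => l; rewrite !tnth_behead !tnth_mktuple tnth_behead.
  congr (if _ then _ else _); rewrite -!val_eqE /= inordK ?ltnS ?ltn_ord //.
move=> a x y /=; case: (unliftP ord0 i) => [j ->|->].
  by rewrite !H1 !B1 IHl bil_r.
by rewrite !H0 !B0 bil_l.
Qed.
End SymFold.

Section SymMaps.
Variable k : comPzRingType.

Section Smul.
Variables (M : lmodType k) (d : nat).
Definition smul1 (x : M) : {linear Sym M d -> Sym M d.+1} :=
  slift (sml_behead x (mon_sml M d.+1)).
Lemma smul1E x t : smul1 x (mon t) = mon [tuple of x :: t].
Proof. exact: sliftE. Qed.
Fact smul_l u : linear (fun x => smul1 x u).
Proof.
move=> a x x'; elim/Sym_ind: u => [|e t u hu]; first by rewrite !linear0 ?scaler0 addr0.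
have E z : [tuple of z :: t] = tset [tuple of 0 :: t] ord0 z.
  apply: eq_from_tnth => j; rewrite tnth_mktuple.
  by case: (unliftP ord0 j) => [j' ->|->]; rewrite ?tnth0 //= !tnthS.
have [_ /(_ [tuple of 0 :: t] ord0 a x x')] := mon_sml M d.+1.
rewrite -!E => H.
rewrite !(linD (smul1 _)) !(linZ (smul1 _)) !smul1E hu H !scalerDr !scalerA [e * a]mulrC.
by rewrite addrACA.
Qed.
Definition smul : bilmap M (Sym M d) (Sym M d.+1) :=
  Bilmap smul_l (fun x => linearP (smul1 x)).
Lemma smulE x t : smul x (mon t) = mon [tuple of x :: t].
Proof. exact: smul1E. Qed.
End Smul.

Lemma smulCA (M : lmodType k) d x y (u : Sym M d) :
  smul M d.+1 x (smul M d y u) = smul M d.+1 y (smul M d x u).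
Proof.
elim/Sym_ind: u => [|e t u hu].
  by rewrite -(scale0r 0) !bilZr !scale0r.
rewrite !bilDr !bilZr !smulE hu; congr (_ *: _ + _).
apply: (mon_sml M d.+2).1 => /=.
by rewrite (perm_catCA [:: x] [:: y]).
Qed.

Fact smap_sml (M N : lmodType k) d (f : {linear M -> N}) :
  symmetric_multilinear (fun t : d.-tuple M => mon [tuple of map f t]).
Proof.
split=> [t t' tt'|t i a x y]; first by apply: (mon_sml N d).1; apply: perm_map.
have E z : [tuple of map f (tset t i z)] = tset [tuple of map f t] i (f z).
  by apply: eq_from_tnth => j; rewrite tnth_map !tnth_mktuple tnth_map; case: eqP.
by rewrite !E linearP; apply: (mon_sml N d).2.
Qed.
Definition smap (M N : lmodType k) d (f : {linear M -> N}) :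
  {linear Sym M d -> Sym N d} := slift (smap_sml d f).
Arguments smap {M N} d f.
Lemma smapE (M N : lmodType k) d (f : {linear M -> N}) (t : d.-tuple M) :
  smap d f (mon t) = mon [tuple of map f t].
Proof. exact: sliftE. Qed.
End SymMaps.

Section Swap.
Variables (k : comPzRingType) (M N : lmodType k).
Definition tswap : {linear tens M N -> tens N M} :=
  tlift (Bilmap (@ten_r k N M) (@ten_l k N M)).
Lemma tswapE x y : tswap (x *t y) = y *t x.
Proof. exact: tliftE. Qed.
End Swap.

(* The coordinate ring of an affine group scheme over [k]: a commutative Hopf *)
(* algebra.                                                                   *)
Record hopfAlgebra (k : comPzRingType) := HopfAlgebra {
  hopf_alg :> comAlg k;
  comul : {linear hopf_alg -> tens hopf_alg hopf_alg};
  counit : {linear hopf_alg -> k^o};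
  antipode : {linear hopf_alg -> hopf_alg};
  comul1 : comul 1 = (1 : hopf_alg) *t (1 : hopf_alg);
  comulM : forall x y, comul (x * y) =
    tmul (alg_mul hopf_alg) (alg_mul hopf_alg) (comul x) (comul y);
  counit1 : counit 1 = 1;
  counitM : forall x y, counit (x * y) = counit x * counit y;
  comulA : forall x, tassoc _ _ _ (tmap comul idfun (comul x)) =
    tmap idfun comul (comul x);
  counit_l : forall x, tcontract _ counit (tswap _ _ (comul x)) = x;
  counit_r : forall x, tcontract _ counit (comul x) = x;
  antipode_l : forall x,
    tlift (alg_mul hopf_alg) (tmap antipode idfun (comul x)) =
      (counit x : k) *: (1 : hopf_alg);
  antipode_r : forall x,
    tlift (alg_mul hopf_alg) (tmap idfun antipode (comul x)) =
      (counit x : k) *: (1 : hopf_alg)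
}.

(* No finiteness is imposed: the group scheme need not be algebraic.          *)
Record affGroupScheme (k : comPzRingType) := Spec { coord_ring : hopfAlgebra k }.

Section GModules.
Variables (k : comPzRingType) (G : affGroupScheme k).
Local Notation kG := (coord_ring G).

Record gmodule := GModule {
  gmod :> lmodType k;
  coact : {linear gmod -> tens gmod kG};
  coactA : forall x, tassoc _ _ _ (tmap coact idfun (coact x)) =
    tmap idfun (comul kG) (coact x);
  coact1 : forall x, tcontract _ (counit kG) (coact x) = x
}.

Definition invariant (M : gmodule) (x : M) : Prop := coact M x = x *t (1 : kG).

Definition gmorph (M N : gmodule) (f : {linear M -> N}) : Prop :=
  forall x, tmap f idfun (coact M x) = coact N (f x).

(* The coaction maps [C] into the image of [C *t kG] in [M *t kG].            *)
Definition gstable (M : gmodule) (C : {pred M}) : Prop :=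
  forall x, x \in C -> exists s : seq (M * kG),
    all (fun p => p.1 \in C) s /\ coact M x = \sum_(p <- s) p.1 *t p.2.

Definition split_surjection (M N : gmodule) (f : {linear M -> N}) : Prop :=
  (forall y, exists x, f x = y) /\
  exists C : {pred M}, [/\ GRing.submod_closed C, gstable C,
    forall x, x \in C -> f x = 0 -> x = 0 &
    forall x, exists y z, [/\ y \in C, f z = 0 & x = y + z]].

Section Trivial.
Variable V : lmodType k.
Definition triv_coact : {linear V -> tens V kG} := lin_of (ten_l (1 : kG)).
Fact triv_coactA x : tassoc _ _ _ (tmap triv_coact idfun (triv_coact x)) =
  tmap idfun (comul kG) (triv_coact x).
Proof. by rewrite !tmapE tassocE comul1. Qed.
Fact triv_coact1 x : tcontract _ (counit kG) (triv_coact x) = x.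
Proof. by rewrite tcontractE counit1 scale1r. Qed.
Definition gtriv : gmodule := GModule triv_coactA triv_coact1.
End Trivial.

Local Notation tmulG b := (tmul b (alg_mul kG)).

Section Equivariant.
Variables (M N P : lmodType k) (b : bilmap M N P).
Variables (rM : {linear M -> tens M kG}) (rN : {linear N -> tens N kG}).
Variable rP : {linear P -> tens P kG}.
Hypothesis rb : forall x y, rP (b x y) = tmulG b (rM x) (rN y).

Let tmulG2 := tmul b (tmul (alg_mul kG) (alg_mul kG)).

Lemma tassoc_tmul (u : tens M kG) (v : tens N kG) (a a' : kG) :
  tassoc _ _ _ (tmulG b u v *t (a * a' : kG)) =
  tmulG2 (tassoc _ _ _ (u *t a)) (tassoc _ _ _ (v *t a')).
Proof.
elim/tens_ind: u => [x c|u u' hu hu']; last first.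
  have D (w w' : tens M kG) (e : kG) : (w + w') *t e = w *t e + w' *t e.
    exact: (bilDl (ten_bil _ _)).
  have D' (w w' : tens P kG) (e : kG) : (w + w') *t e = w *t e + w' *t e.
    exact: (bilDl (ten_bil _ _)).
  by rewrite bilDl D D' !linD bilDl hu hu'.
elim/tens_ind: v => [y c'|v v' hv hv']; last first.
  have D (w w' : tens N kG) (e : kG) : (w + w') *t e = w *t e + w' *t e.
    exact: (bilDl (ten_bil _ _)).
  have D' (w w' : tens P kG) (e : kG) : (w + w') *t e = w *t e + w' *t e.
    exact: (bilDl (ten_bil _ _)).
  by rewrite bilDr D D' !linD bilDr hv hv'.
by rewrite tmulE !tassocE /tmulG2 tmulE tmulE.
Qed.

Lemma coactA_bil x y :
  tassoc _ _ _ (tmap rM idfun (rM x)) = tmap idfun (comul kG) (rM x) ->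
  tassoc _ _ _ (tmap rN idfun (rN y)) = tmap idfun (comul kG) (rN y) ->
  tassoc _ _ _ (tmap rP idfun (rP (b x y))) =
    tmap idfun (comul kG) (rP (b x y)).
Proof.
have H1 u v : tassoc _ _ _ (tmap rP idfun (tmulG b u v)) =
    tmulG2 (tassoc _ _ _ (tmap rM idfun u)) (tassoc _ _ _ (tmap rN idfun v)).
  elim/tens_ind: u => [m a|u u' hu hu']; last by rewrite !(bilDl, linD) hu hu'.
  elim/tens_ind: v => [n a'|v v' hv hv']; last by rewrite !(bilDr, linD) hv hv'.
  by rewrite tmulE !tmapE rb tassoc_tmul.
have H2 u v : tmap idfun (comul kG) (tmulG b u v) =
    tmulG2 (tmap idfun (comul kG) u) (tmap idfun (comul kG) v).
  elim/tens_ind: u => [m a|u u' hu hu']; last by rewrite !(bilDl, linD) hu hu'.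
  elim/tens_ind: v => [n a'|v v' hv hv']; last by rewrite !(bilDr, linD) hv hv'.
  by rewrite tmulE !tmapE /tmulG2 tmulE /= comulM.
by move=> hx hy; rewrite rb H1 H2 hx hy.
Qed.

Lemma coact1_bil x y :
  tcontract _ (counit kG) (rM x) = x -> tcontract _ (counit kG) (rN y) = y ->
  tcontract _ (counit kG) (rP (b x y)) = b x y.
Proof.
have H u v : tcontract _ (counit kG) (tmulG b u v) =
    b (tcontract _ (counit kG) u) (tcontract _ (counit kG) v).
  elim/tens_ind: u => [m a|u u' hu hu']; last by rewrite !(bilDl, linD) hu hu'.
  elim/tens_ind: v => [n a'|v v' hv hv']; last by rewrite !(bilDr, linD) hv hv'.
  by rewrite tmulE !tcontractE /= counitM bilZl bilZr scalerA.
by move=> hx hy; rewrite rb H hx hy.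
Qed.
End Equivariant.

Section TensorModule.
Variables M N : gmodule.
Fact gtens_l (y : N) : linear (fun x : M => tmulG (ten_bil M N) (coact M x) (coact N y)).
Proof. by move=> a x x'; rewrite linearP bil_l. Qed.
Fact gtens_r (x : M) : linear (fun y : N => tmulG (ten_bil M N) (coact M x) (coact N y)).
Proof. by move=> a y y'; rewrite linearP bil_r. Qed.
Definition gtens_coact : {linear tens M N -> tens (tens M N) kG} :=
  tlift (Bilmap gtens_l gtens_r).
Lemma gtens_coactE x y :
  gtens_coact (ten_bil M N x y) = tmulG (ten_bil M N) (coact M x) (coact N y).
Proof. exact: tliftE. Qed.
Fact gtens_coactA u : tassoc _ _ _ (tmap gtens_coact idfun (gtens_coact u)) =
  tmap idfun (comul kG) (gtens_coact u).
Proof.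
elim/tens_ind: u => [x y|u v hu hv]; last by rewrite !linD hu hv.
exact: (coactA_bil gtens_coactE (coactA x) (coactA y)).
Qed.
Fact gtens_coact1 u : tcontract _ (counit kG) (gtens_coact u) = u.
Proof.
elim/tens_ind: u => [x y|u v hu hv]; last by rewrite !linD hu hv.
exact: (coact1_bil gtens_coactE (coact1 x) (coact1 y)).
Qed.
Definition gtens : gmodule := GModule gtens_coactA gtens_coact1.
End TensorModule.

(* The coaction of [x_1 ... x_d] is the product of the coactions of the x_i,  *)
(* for (M *t kG) * (Sym n M *t kG) -> Sym n.+1 M *t kG.                       *)
Section SymModule.
Variable M : gmodule.
Local Notation tmulS := (fun n => tmulG (smul M n)).

Fact tmulS_CA n u v (w : tens (Sym M n) kG) :
  tmulS n.+1 u (tmulS n v w) = tmulS n.+1 v (tmulS n u w).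
Proof.
elim/tens_ind: u => [x a|u u' hu hu']; last by rewrite !(bilDl, bilDr) hu hu'.
elim/tens_ind: v => [y c|v v' hv hv']; last by rewrite !(bilDl, bilDr) hv hv'.
elim/tens_ind: w => [z e|w w' hw hw']; last by rewrite !bilDr hw hw'.
by rewrite !tmulE smulCA; congr (_ *t _); apply: mulrCA.
Qed.

Definition sym_coact_fun d (t : d.-tuple M) : tens (Sym M d) kG :=
  sfold tmulS (mon [tuple] *t (1 : kG)) [tuple of map (coact M) t].

Fact sym_coact_sml d : symmetric_multilinear (@sym_coact_fun d).
Proof.
have [fs fl] := sfold_sml (mon [tuple] *t (1 : kG)) tmulS_CA d.
split=> [t t' tt'|t i a x y]; first by apply: fs; apply: perm_map.
have E z : [tuple of map (coact M) (tset t i z)] =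
    tset [tuple of map (coact M) t] i (coact M z).
  by apply: eq_from_tnth => j; rewrite tnth_map !tnth_mktuple tnth_map; case: eqP.
by rewrite /sym_coact_fun !E linearP; apply: fl.
Qed.
Definition sym_coact d : {linear Sym M d -> tens (Sym M d) kG} :=
  slift (@sym_coact_sml d).

Lemma sym_coact_cons d x u :
  sym_coact d.+1 (smul M d x u) = tmulG (smul M d) (coact M x) (sym_coact d u).
Proof.
elim/Sym_ind: u => [|a t u hu].
  by rewrite -(scale0r 0) bilZr !linZ bilZr !scale0r.
rewrite bilDr bilZr 2!linD 2!linZ bilDr bilZr hu smulE !sliftE.
congr (_ *: _ + _); rewrite /sym_coact_fun.
have -> : [tuple of map (coact M) [tuple of x :: t]] =
    [tuple of coact M x :: [tuple of map (coact M) t]] by apply: val_inj.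
by rewrite sfold_cons.
Qed.

Lemma sym_coact_nil : sym_coact 0 (mon [tuple]) = mon [tuple] *t (1 : kG).
Proof. by rewrite sliftE. Qed.

Fact sym_coactA d u : tassoc _ _ _ (tmap (sym_coact d) idfun (sym_coact d u)) =
  tmap idfun (comul kG) (sym_coact d u).
Proof.
elim/Sym_ind: u => [|a t u hu]; first by rewrite !linear0.
suff h : tassoc _ _ _ (tmap (sym_coact d) idfun (sym_coact d (mon t))) =
    tmap idfun (comul kG) (sym_coact d (mon t)) by rewrite 4!linD 4!linZ h hu.
elim: d t {u hu} => [|d IH] t.
  by rewrite tuple0 sym_coact_nil !tmapE sym_coact_nil tassocE comul1.
case/tupleP: t => x t; rewrite -smulE.
exact: (coactA_bil (@sym_coact_cons d) (coactA x) (IH t)).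
Qed.
Fact sym_coact1 d u : tcontract _ (counit kG) (sym_coact d u) = u.
Proof.
elim/Sym_ind: u => [|a t u hu]; first by rewrite !linear0.
suff h : tcontract _ (counit kG) (sym_coact d (mon t)) = mon t.
  by rewrite 2!linD 2!linZ h hu.
elim: d t {u hu} => [|d IH] t.
  by rewrite tuple0 sym_coact_nil tcontractE counit1 scale1r.
case/tupleP: t => x t; rewrite -smulE.
exact: (coact1_bil (@sym_coact_cons d) (coact1 x) (IH t)).
Qed.
Definition gsym d : gmodule := GModule (@sym_coactA d) (@sym_coact1 d).
End SymModule.
End GModules.

Section BilComp.
Variables (k : comPzRingType) (M N P M' N' : lmodType k) (b : bilmap M N P).
Variables (f : {linear M' -> M}) (g : {linear N' -> N}).
Fact bilcomp_l y : linear (fun x => b (f x) (g y)).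
Proof. by move=> a x x'; rewrite linearP bil_l. Qed.
Fact bilcomp_r x : linear (fun y => b (f x) (g y)).
Proof. by move=> a y y'; rewrite linearP bil_r. Qed.
Definition bilcomp : bilmap M' N' P := Bilmap bilcomp_l bilcomp_r.
End BilComp.

Section Antipode.
Variables (k : comPzRingType) (A : hopfAlgebra k).
Local Notation S := (antipode A).
Local Notation D := (comul A).
Let AA := tens A A.
Let mB : bilmap AA AA AA := tmul (alg_mul A) (alg_mul A).
Let oneB : AA := (1 : A) *t (1 : A).

Let mBA u v w : mB u (mB v w) = mB (mB u v) w.
Proof.
elim/tens_ind: u => [x a|u u' hu hu']; last by rewrite !bilDl hu hu'.
elim/tens_ind: v => [y c|v v' hv hv']; last by rewrite bilDl !bilDr bilDl hv hv'.
elim/tens_ind: w => [z e|w w' hw hw']; last by rewrite !bilDr hw hw'.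
by rewrite /mB !tmulE /= !mulrA.
Qed.
Let mB1 u : mB u oneB = u.
Proof.
elim/tens_ind: u => [x a|u u' hu hu']; last by rewrite bilDl hu hu'.
by rewrite /mB tmulE /= !mulr1.
Qed.
Let mB1l u : mB oneB u = u.
Proof.
elim/tens_ind: u => [x a|u u' hu hu']; last by rewrite bilDr hu hu'.
by rewrite /mB tmulE /= !mul1r.
Qed.

Let Z : {linear AA -> AA} := tswap _ _ \o tmap S S.
Let ZE (x y : A) : Z (x *t y) = S y *t S x.
Proof. by rewrite -[LHS]/(tswap A A (tmap S S (x *t y))) tmapE tswapE. Qed.
Let K : {linear tens A AA -> AA} :=
  tlift (bilcomp mB (lin_of (ten_r (1 : A))) Z).
Let L : {linear tens A (tens A AA) -> AA} :=
  tlift (bilcomp mB (lin_of (ten_l (1 : A))) K).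

Let KE (p : A) w : K (p *t w) = mB ((1 : A) *t p) (Z w).
Proof. exact: tliftE. Qed.
Let LE (p : A) w : L (p *t w) = mB (p *t (1 : A)) (K w).
Proof. exact: tliftE. Qed.

Let tassocD (u : AA) :
  tassoc _ _ _ (tmap D D u) = tmap idfun (tmap idfun D) (tassoc _ _ _ (tmap D idfun u)).
Proof.
elim/tens_ind: u => [x y|u v hu hv]; last by rewrite !linD hu hv.
rewrite !tmapE; elim/tens_ind: (D x) => [p q|u v hu hv].
  by rewrite !tassocE !tmapE.
have E (w : AA) : (u + v) *t w = u *t w + v *t w by exact: (bilDl (ten_bil _ _)).
have E' (w : A) : (u + v) *t w = u *t w + v *t w by exact: (bilDl (ten_bil _ _)).
by rewrite E E' !linD hu hv.
Qed.

Let L_tassoc (u w : AA) : L (tassoc _ _ _ (u *t w)) = mB u (Z w).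
Proof.
elim/tens_ind: u => [p q|u v hu hv].
  by rewrite tassocE LE KE mBA {1}/mB tmulE /= mulr1 mul1r.
have E : (u + v) *t w = u *t w + v *t w by exact: (bilDl (ten_bil _ _)).
by rewrite E !linD hu hv bilDl.
Qed.

Let K_tassoc (t : AA) :
  K (tassoc _ _ _ (tmap D idfun t)) = S (tcontract _ (counit A) (tswap _ _ t)) *t (1 : A).
Proof.
elim/tens_ind: t => [q s|u v hu hv]; last first.
  by rewrite !linD hu hv; symmetry; exact: (bilDl (ten_bil _ _)).
rewrite tmapE tswapE tcontractE linZ.
have H (u : AA) : K (tassoc _ _ _ (u *t (s : A))) =
    S s *t (tlift (alg_mul A) (tmap idfun S u)).
  elim/tens_ind: u => [q1 q2|u v hu hv].
    by rewrite tassocE KE ZE tmapE tliftE /mB tmulE /= mul1r.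
  have E : (u + v) *t s = u *t s + v *t s by exact: (bilDl (ten_bil _ _)).
  by rewrite E !linD hu hv; symmetry; exact: (bilDr (ten_bil _ _)).
rewrite H antipode_r -[LHS]/(ten_bil _ _ _ _) -[RHS]/(ten_bil _ _ _ _).
by rewrite bilZl bilZr.
Qed.

Let conv_DZ a : tlift (bilcomp mB D (Z \o D)) (D a) = (counit A a : k) *: oneB.
Proof.
have H1 (u : AA) : tlift (bilcomp mB D (Z \o D)) u = L (tassoc _ _ _ (tmap D D u)).
  elim/tens_ind: u => [x y|u v hu hv]; last by rewrite !linD hu hv.
  by rewrite tliftE tmapE L_tassoc.
rewrite H1 tassocD comulA.
have H2 (u : AA) : L (tmap idfun (tmap idfun D) (tmap idfun D u)) =
    tlift (alg_mul A) (tmap idfun S u) *t (1 : A).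
  elim/tens_ind: u => [x y|u v hu hv]; last first.
    by rewrite !linD hu hv; symmetry; exact: (bilDl (ten_bil _ _)).
  rewrite !tmapE -comulA LE K_tassoc counit_l tliftE /mB tmulE /=.
  by rewrite mulr1.
by rewrite H2 antipode_r -[LHS]/(ten_bil _ _ _ _) bilZl.
Qed.

Let conv_SD a : tlift (bilcomp mB (D \o S) D) (D a) = (counit A a : k) *: oneB.
Proof.
have H (u : AA) : tlift (bilcomp mB (D \o S) D) u =
    D (tlift (alg_mul A) (tmap S idfun u)).
  elim/tens_ind: u => [x y|u v hu hv]; last by rewrite !linD hu hv.
  by rewrite tliftE tmapE tliftE /= comulM.
by rewrite H antipode_l linZ comul1.
Qed.

Lemma comul_antipode a : D (S a) = tswap _ _ (tmap S S (D a)).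
Proof.
pose X : {linear A -> AA} := D \o S; pose W : {linear A -> AA} := Z \o D.
pose conv (f g : {linear A -> AA}) : {linear A -> AA} := tlift (bilcomp mB f g) \o D.
have convA a' : conv (conv X D) W a' = conv X (conv D W) a'.
  have H (u : AA) : tlift (bilcomp mB (tlift (bilcomp mB X D) \o D) W) u =
      tlift (bilcomp mB X (tlift (bilcomp mB D W))) (tassoc _ _ _ (tmap D idfun u)).
    elim/tens_ind: u => [x y|u v hu hv]; last by rewrite !linD hu hv.
    rewrite tliftE tmapE -[LHS]/(mB (tlift (bilcomp mB X D) (D x)) (W y)).
    elim/tens_ind: (D x) => [p q|u v hu hv].
      rewrite tassocE !tliftE -[RHS]/(mB (X p) (tlift (bilcomp mB D W) (q *t y))).
      by rewrite tliftE -[RHS]/(mB (X p) (mB (D q) (W y))) mBA.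
    have E : (u + v) *t y = u *t y + v *t y by exact: (bilDl (ten_bil _ _)).
    by rewrite E !linD bilDl hu hv.
  have H' (u : AA) : tlift (bilcomp mB X (tlift (bilcomp mB D W))) (tmap idfun D u) =
      tlift (bilcomp mB X (tlift (bilcomp mB D W) \o D)) u.
    elim/tens_ind: u => [x y|u v hu hv]; last by rewrite !linD hu hv.
    by rewrite tmapE !tliftE.
  rewrite -[LHS]/(tlift (bilcomp mB (tlift (bilcomp mB X D) \o D) W) (D a')) H comulA H'.
  by [].
have E1 a' : conv (conv X D) W a' = W a'.
  have H (u : AA) : tlift (bilcomp mB (tlift (bilcomp mB X D) \o D) W) u =
      W (tcontract _ (counit A) (tswap _ _ u)).
    elim/tens_ind: u => [x y|u v hu hv]; last by rewrite !linD hu hv.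
    rewrite tliftE tswapE tcontractE linZ.
    rewrite -[LHS]/(mB (tlift (bilcomp mB (D \o S) D) (D x)) (W y)).
    by rewrite conv_SD bilZl mB1l.
  by rewrite -[LHS]/(tlift (bilcomp mB (tlift (bilcomp mB X D) \o D) W) (D a')) H counit_l.
have E2 a' : conv X (conv D W) a' = X a'.
  have H (u : AA) : tlift (bilcomp mB X (tlift (bilcomp mB D W) \o D)) u =
      X (tcontract _ (counit A) u).
    elim/tens_ind: u => [x y|u v hu hv]; last by rewrite !linD hu hv.
    rewrite tliftE tcontractE linZ.
    rewrite -[LHS]/(mB (X x) (tlift (bilcomp mB D (Z \o D)) (D y))).
    by rewrite conv_DZ bilZr mB1.
  by rewrite -[LHS]/(tlift (bilcomp mB X (tlift (bilcomp mB D W) \o D)) (D a')) H counit_r.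
by rewrite -[LHS]/(X a) -E2 -convA E1.
Qed.

Lemma counit_antipode a : counit A (S a) = counit A a.
Proof.
have H (u : AA) : counit A (tlift (alg_mul A) (tmap S idfun u)) =
    counit A (S (tcontract _ (counit A) u)).
  elim/tens_ind: u => [x y|u v hu hv]; last by rewrite !linD hu hv.
  by rewrite tmapE tliftE tcontractE /= counitM !linZ mulrC.
have := H (D a); rewrite counit_r => <-.
by rewrite antipode_l linZ counit1 -[LHS]/(_ * _) mulr1.
Qed.
End Antipode.

Section DualModule.
Variables (k : comPzRingType) (M : lmodType k).

Definition linear_form : {pred M -> k^o} := fun f => `[< linear f >].
Fact linear_form_submod : GRing.submod_closed linear_form.
Proof.
split=> [|a f g /asboolP lf /asboolP lg]; apply/asboolP => e x y.
  by rewrite scaler0 addr0.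
rewrite -[LHS]/(a *: f (e *: x + y) + g (e *: x + y)) lf lg.
rewrite -[RHS]/(e *: (a *: f x + g x) + (a *: f y + g y)).
by rewrite !scalerDr !scalerA [e * a]mulrC addrACA.
Qed.
HB.instance Definition _ :=
  GRing.isSubmodClosed.Build k (M -> k^o) linear_form linear_form_submod.

Record dual := Dual { dual_fun :> M -> k^o; _ : dual_fun \in linear_form }.
HB.instance Definition _ := [isSub for dual_fun].
HB.instance Definition _ := [Choice of dual by <:].
HB.instance Definition _ := [SubChoice_isSubLmodule of dual by <:].

Lemma dual_linear (f : dual) : linear f.
Proof. by case: f => f /= /asboolP. Qed.
Definition dual_lin (f : dual) : {linear M -> k^o} := lin_of (dual_linear f).

Fact form_dual_subproof (f : {linear M -> k^o}) : (f : M -> k^o) \in linear_form.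
Proof. by apply/asboolP => a x y; apply: linearP. Qed.
Definition form_dual (f : {linear M -> k^o}) : dual := Dual (form_dual_subproof f).

Lemma dual_ext (f g : dual) : f =1 g -> f = g.
Proof. by move=> fg; apply: val_inj; apply: funext. Qed.
Lemma dualDE (f g : dual) x : (f + g) x = f x + g x. Proof. by []. Qed.
Lemma dualZE a (f : dual) x : (a *: f) x = a * f x. Proof. by []. Qed.
End DualModule.

Section DualMap.
Variables (k : comPzRingType) (M N : lmodType k) (f : {linear M -> N}).
Fact dual_map_subproof (g : dual N) : linear (fun x => g (f x)).
Proof. by move=> a x y; rewrite linearP dual_linear. Qed.
Definition dual_map_fun (g : dual N) : dual M := form_dual (lin_of (dual_map_subproof g)).
Fact dual_map_linear : linear dual_map_fun.
Proof. by move=> a g h; apply: dual_ext. Qed.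
Definition dual_map : {linear dual N -> dual M} := lin_of dual_map_linear.
End DualMap.

Definition fg_projective (k : comPzRingType) (M : lmodType k) : Prop :=
  exists n (p : {linear 'rV[k]_n -> M}) (s : {linear M -> 'rV[k]_n}), cancel s p.

Definition fg_free (k : comPzRingType) (M : lmodType k) : Prop :=
  exists n (p : {linear 'rV[k]_n -> M}), bijective p.

Lemma fg_free_projective (k : comPzRingType) (M : lmodType k) :
  fg_free M -> fg_projective M.
Proof.
case=> n [p [s ps sp]]; exists n, p, (lin_of (can2_linear ps sp)); exact: sp.
Qed.

Lemma fg_dual_basis (k : comPzRingType) (M : lmodType k) : fg_projective M ->
  exists n (e : 'I_n -> M) (c : 'I_n -> dual M), forall x, x = \sum_i c i x *: e i.
Proof.
case=> n [p [s sp]].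
have cl i : linear (fun x => s x 0 i : k^o).
  by move=> a x y; rewrite linearP !mxE.
exists n, (fun i => p (delta_mx 0 i)), (fun i => form_dual (lin_of (cl i))) => x.
rewrite -[LHS]sp [s x]row_sum_delta linear_sum; apply: eq_bigr => i _.
by rewrite linZ.
Qed.

(* For [M] finitely generated projective, the coaction of [f] in the dual of  *)
(* [M] is characterized (lemma [dual_coactP]) by                              *)
(*   evaluation at x of (coaction of f) = sum of f x_0 *: S x_1,              *)
(* where x_0 *t x_1 is the coaction of x and S the antipode, that is          *)
(* (g f) x = f (g^-1 x); it is written here with a dual basis (e_i, c_i).     *)
Section DualGModule.
Variables (k : comPzRingType) (G : affGroupScheme k) (M : gmodule G).
Hypothesis Mfg : fg_projective M.
Local Notation kG := (coord_ring G).
Local Notation S := (antipode kG).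

Definition db_size := sval (cid (fg_dual_basis Mfg)).
Definition db_vec : 'I_db_size -> M := sval (cid (svalP (cid (fg_dual_basis Mfg)))).
Definition db_form : 'I_db_size -> dual M :=
  sval (cid (svalP (cid (svalP (cid (fg_dual_basis Mfg)))))).
Lemma dual_basisP x : x = \sum_i db_form i x *: db_vec i.
Proof. exact: (svalP (cid (svalP (cid (svalP (cid (fg_dual_basis Mfg))))))). Qed.

Fact contra_l (f : dual M) a : linear (fun x => (f x : k) *: S a).
Proof. by move=> e x y; rewrite dual_linear scalerDl scalerA. Qed.
Fact contra_r (f : dual M) x : linear (fun a => (f x : k) *: S a).
Proof. by move=> e a a'; rewrite (linearP S) scalerDr !scalerA mulrC. Qed.
Definition contra (f : dual M) : {linear tens M kG -> kG} :=
  tlift (Bilmap (contra_l f) (contra_r f)).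
Lemma contraE f x a : contra f (x *t a) = (f x : k) *: S a.
Proof. exact: tliftE. Qed.

Fact contra_linear u : linear (contra^~ u).
Proof.
move=> e f g; elim/tens_ind: u => [x a|u v hu hv].
  by rewrite !contraE dualDE dualZE scalerDl scalerA.
by rewrite 3!(linD (contra _)) hu hv scalerDr addrACA.
Qed.

Definition dual_coact_fun (f : dual M) : tens (dual M) kG :=
  \sum_i db_form i *t contra f (coact M (db_vec i)).
Fact dual_coact_linear : linear dual_coact_fun.
Proof.
move=> a f g; rewrite /dual_coact_fun scaler_sumr -big_split.
by apply: eq_bigr => i _; rewrite contra_linear [LHS]ten_r.
Qed.
Definition dual_coact : {linear dual M -> tens (dual M) kG} :=
  lin_of dual_coact_linear.

Section Eval.
Variable B : lmodType k.
Fact eval_l (x : M) (b : B) : linear (fun f : dual M => (f x : k) *: b).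
Proof. by move=> e f g; rewrite dualDE dualZE scalerDl scalerA. Qed.
Fact eval_r (x : M) (f : dual M) : linear (fun b : B => (f x : k) *: b).
Proof. by move=> e b b'; rewrite scalerDr !scalerA mulrC. Qed.
Definition evalx (x : M) : {linear tens (dual M) B -> B} :=
  tlift (Bilmap (eval_l x) (@eval_r x)).
Lemma evalxE x f b : evalx x (f *t b) = (f x : k) *: b.
Proof. exact: tliftE. Qed.

Lemma evalx_inj (u v : tens (dual M) B) : (forall x, evalx x u = evalx x v) -> u = v.
Proof.
have H w : w = \sum_i db_form i *t evalx (db_vec i) w.
  elim/tens_ind: w => [f b|w w' hw hw']; last first.
    rewrite {1}hw {1}hw' -big_split; apply: eq_bigr => i _.
    by rewrite linD; symmetry; exact: (bilDr (ten_bil _ _)).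
  have E : f = \sum_i (f (db_vec i) : k) *: db_form i.
    apply: dual_ext => x; rewrite {1}(dual_basisP x).
    rewrite -[LHS]/(dual_lin f _) linear_sum.
    rewrite -[RHS]/(val (\sum_i _) x) raddf_sum fct_sumE; apply: eq_bigr => i _.
    by rewrite linZ; apply: mulrC.
  rewrite {1}E -[LHS]/(lin_of (ten_l b) _) linear_sum; apply: eq_bigr => i _.
  rewrite linZ evalxE /= -[LHS]/(_ *: ten_bil _ _ _ _) -[RHS]/(ten_bil _ _ _ _).
  by rewrite bilZr.
by move=> uv; rewrite (H u) (H v); apply: eq_bigr => i _; rewrite uv.
Qed.
End Eval.

Lemma dual_coactP f x : evalx kG x (dual_coact f) = contra f (coact M x).
Proof.
rewrite -[dual_coact f]/(dual_coact_fun f) /dual_coact_fun linear_sum.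
rewrite {2}(dual_basisP x) !linear_sum; apply: eq_bigr => i _.
by rewrite evalxE !linZ.
Qed.

Let SS : {linear tens kG kG -> tens kG kG} := tswap _ _ \o tmap S S.
Let SSE a b : SS (a *t b) = S b *t S a.
Proof. by rewrite -[LHS]/(tswap kG kG (tmap S S (a *t b))) tmapE tswapE. Qed.

Fact dual_coactA f : tassoc _ _ _ (tmap dual_coact idfun (dual_coact f)) =
  tmap idfun (comul kG) (dual_coact f).
Proof.
apply: evalx_inj => x.
have RHS_ w : evalx (tens kG kG) x (tmap idfun (comul kG) w) =
    comul kG (evalx kG x w).
  elim/tens_ind: w => [g a|w w' hw hw']; last by rewrite !linD hw hw'.
  by rewrite tmapE !evalxE linZ.
have evl (w : tens (dual M) kG) (c : kG) : linear (fun y => S c *t evalx kG y w).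
  move=> e y y'; elim/tens_ind: w => [g a|w w' hw hw'].
    have E : (g (e *: y + y') : k) *: a = e *: ((g y : k) *: a) + (g y' : k) *: a.
      by rewrite dual_linear scalerDl scalerA.
    by rewrite !evalxE E; apply: ten_r.
  have D (b b' : kG) : S c *t (b + b') = S c *t b + S c *t b'.
    exact: (bilDr (ten_bil _ _)).
  by rewrite !(linD (evalx _ _)) !D hw hw' scalerDr addrACA.
have evr (w : tens (dual M) kG) (y : M) : linear (fun c => S c *t evalx kG y w).
  by move=> e c c'; rewrite (linearP S); apply: ten_l.
pose R w : {linear tens M kG -> tens kG kG} := tlift (Bilmap (evl w) (evr w)).
have RE w y c : R w (y *t c) = S c *t evalx kG y w by exact: tliftE.
have RD w w' u : R (w + w') u = R w u + R w' u.
  elim/tens_ind: u => [y c|u u' hu hu']; last by rewrite !linD hu hu' addrACA.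
  by rewrite !RE linD; apply: (bilDr (ten_bil _ _)).
have tassoc_eval (w : tens (dual M) kG) (a : kG) :
    evalx (tens kG kG) x (tassoc _ _ _ (w *t a)) = evalx kG x w *t a.
  elim/tens_ind: w => [g c|w w' hw hw'].
    by rewrite tassocE !evalxE; symmetry; exact: (bilZl (ten_bil _ _)).
  have D : (w + w') *t a = w *t a + w' *t a by exact: (bilDl (ten_bil _ _)).
  by rewrite D !linD hw hw'; symmetry; exact: (bilDl (ten_bil _ _)).
have LHS_ w : evalx (tens kG kG) x (tassoc _ _ _ (tmap dual_coact idfun w)) =
    R w (coact M x).
  elim/tens_ind: w => [g a|w w' hw hw']; last by rewrite !linD RD hw hw'.
  rewrite tmapE tassoc_eval dual_coactP.
  elim/tens_ind: (coact M x) => [y c|u u' hu hu']; last first.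
    by rewrite !linD -hu -hu'; exact: (bilDl (ten_bil _ _)).
  rewrite RE evalxE contraE -[LHS]/(ten_bil _ _ _ _) -[RHS]/(ten_bil _ _ _ _).
  by rewrite bilZl bilZr.
have Nl w : linear (fun y => (f y : k) *: SS w).
  by move=> e y y'; rewrite dual_linear scalerDl scalerA.
have Nr y : linear (fun w => (f y : k) *: SS w).
  by move=> e w w'; rewrite (linearP SS) scalerDr !scalerA mulrC.
pose N : {linear tens M (tens kG kG) -> tens kG kG} := tlift (Bilmap Nl Nr).
have NE y w : N (y *t w) = (f y : k) *: SS w by exact: tliftE.
have DN u : comul kG (contra f u) = N (tmap idfun (comul kG) u).
  elim/tens_ind: u => [y c|u u' hu hu']; last by rewrite !linD hu hu'.
  by rewrite contraE linZ comul_antipode tmapE NE.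
have RN u : R (dual_coact f) u = N (tassoc _ _ _ (tmap (coact M) idfun u)).
  elim/tens_ind: u => [y c|u u' hu hu']; last by rewrite !linD hu hu'.
  rewrite RE dual_coactP tmapE.
  elim/tens_ind: (coact M y) => [y' c'|u u' hu hu'].
    rewrite contraE tassocE NE SSE; exact: (bilZr (ten_bil _ _)).
  have D : (u + u') *t c = u *t c + u' *t c by exact: (bilDl (ten_bil _ _)).
  by rewrite D !linD -hu -hu'; exact: (bilDr (ten_bil _ _)).
by rewrite LHS_ RHS_ dual_coactP RN coactA DN.
Qed.

Fact dual_coact1 f : tcontract _ (counit kG) (dual_coact f) = f.
Proof.
apply: dual_ext => x.
have H (w : tens (dual M) kG) :
    dual_fun (tcontract (dual M) (counit kG) w) x = counit kG (evalx kG x w).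
  elim/tens_ind: w => [g a|w w' hw hw']; last by rewrite !linD dualDE hw hw'.
  by rewrite tcontractE evalxE linZ dualZE; apply: mulrC.
rewrite H dual_coactP -{2}(coact1 x).
elim/tens_ind: (coact M x) => [y c|u u' hu hu'].
  rewrite contraE linZ counit_antipode tcontractE -[RHS]/(dual_lin f _) linZ.
  exact: mulrC.
by rewrite !linD hu hu' -[RHS]/(dual_lin f _) linD.
Qed.

Definition gdual : gmodule G := GModule dual_coactA dual_coact1.
End DualGModule.

Section Reductivity.
Variables (k : comPzRingType) (G : affGroupScheme k).

Definition power_reductive : Prop :=
  forall (M : gmodule G) (phi : {linear M -> k^o}),
  gmorph (N := gtriv G k^o) phi -> (forall y, exists x, phi x = y) ->
  exists2 d, (0 < d)%N &
    split_surjection (M := gsym M d) (N := gsym (gtriv G k^o) d) (smap d phi).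

Definition geom_reductive_field : Prop :=
  forall (M : gmodule G) (Mfin : fg_free M) (phi : {linear k^o -> M}),
  gmorph (M := gtriv G k^o) phi -> injective phi ->
  exists2 d, (0 < d)%N &
    exists2 f : Sym (dual M) d,
      invariant (M := gsym (gdual (fg_free_projective Mfin)) d) f &
      smap d (dual_map phi) f != 0.

(* The value at [v] in [F *t M] of a polynomial [f_1 ... f_d], the f_i being  *)
(* linear forms on [M], is the product of the (id_F *t f_i) v.                *)
Section Evaluation.
Variables (M : lmodType k) (F : comAlg k) (v : tens F M).
Definition eval_form (f : dual M) : F := tcontract F (dual_lin f) v.
Fact eval_form_linear : linear eval_form.
Proof.
move=> a f g; rewrite /eval_form; elim/tens_ind: v => [c x|u u' hu hu'].
  rewrite !tcontractE -[dual_lin (_ + _) x]/((a : k) * f x + g x).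
  by rewrite scalerDl scalerA.
by rewrite 3!(linD (tcontract _ _)) hu hu' scalerDr addrACA.
Qed.
Fact sym_eval_subproof d :
  symmetric_multilinear (fun t : d.-tuple (dual M) => \prod_(f <- t) eval_form f).
Proof.
split=> [t t' tt'|t i a f g]; first exact: perm_big.
have E h : \prod_(f0 <- tset t i h) eval_form f0 =
    eval_form h * \prod_(j < d | j != i) eval_form (tnth t j).
  rewrite big_tuple (bigD1 i) //= tnth_mktuple eqxx; congr (_ * _).
  by apply: eq_bigr => j /negPf ji; rewrite tnth_mktuple ji.
by rewrite !E eval_form_linear mulrDl alg_scaleAl.
Qed.
Definition sym_eval d : {linear Sym (dual M) d -> F} := slift (sym_eval_subproof d).
End Evaluation.

Definition geom_reductive_ring : Prop :=
  forall (M : gmodule G) (Mfree : fg_free M) (F : comAlg k),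
  is_field (alg_ring F) -> forall v : tens F M,
  invariant (M := gtens (gtriv G F) M) v -> v != 0 ->
  exists2 d, (0 < d)%N &
    exists2 f : Sym (dual M) d,
      invariant (M := gsym (gdual (fg_free_projective Mfree)) d) f &
      sym_eval v d f != 0.

Definition geometrically_reductive : Prop :=
  (is_field k -> geom_reductive_field) /\ (~ is_field k -> geom_reductive_ring).
End Reductivity.

(* Main.v *)
(* For v in (F *t M)^G nonzero, evaluation at v is a G-map ev from the dual of  *)
(* M to F, and b = ev f0 is nonzero for some form f0.  The module               *)
(* K = {(f, c) | ev f = c b}, a G-submodule of the sum of the dual of M and k   *)
(* by flatness, surjects onto k by (f, c) |-> c.  Power reductivity gives an    *)
(* invariant in some S^d K over 1 in S^d k; its image in S^d of the dual of M   *)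
(* takes the value b^d at v.  This works over any k; when k is a field, the     *)
(* field version of geometric reductivity is the case F = k.                    *)

From HB Require Import structures.
From mathcomp Require Import all_boot all_algebra.
From mathcomp Require Import boolp.
Require Import Defs.

Set Implicit Arguments.
Unset Strict Implicit.
Unset Printing Implicit Defensive.

Import GRing.Theory.
Local Open Scope ring_scope.
Local Open Scope quotient_scope.

(** Everything reduces to the ring form, proved over an arbitrary base. An invariant v of F ⊗ M
    makes the evaluation M^∨ → F, f ↦ f(v), equivariant ([eval_lin_gmorph]), and if v is nonzero
    then some form f0 has b = f0(v) nonzero ([eval_form_neq0]).

    Power reductivity speaks only of surjections onto k, whereas the evaluation lands in F. Pulling
    it back along k → F, c ↦ c b, produces such a surjection: its source is the fibre product K of
    M^∨ and k over F, which contains (f0, 1). Flatness makes K a G-module: tensoring with k[G]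
    preserves the exactness that defines a kernel ([flat_exact]), so the coaction restricts to it
    ([gker]).

    A splitting of S^d K → S^d k yields an invariant of S^d K above the generator of S^d k
    ([power_reductive_invariant]). On K the evaluation is b times the projection to k, so the image
    of this invariant in S^d(M^∨) takes the value b^d at v ([power_reductive_eval]), which is
    nonzero in a field.

    When k is a field, an embedding phi of k in M gives the vector v = 1 ⊗ phi(1) with F = k, and
    evaluation at v factors through restriction along phi ([geom_reductive_ring_field]). *)

(** * Cokernels, and exactness under a flat tensor product *)

Section Cokernel.
Variables (k : comPzRingType) (U V : lmodType k) (f : {linear U -> V}).

Definition range_pred : {pred V} := fun x => `[< exists u, f u = x >].
Fact range_submod : GRing.submod_closed range_pred.
Proof.
split=> [|a x y /asboolP[u <-] /asboolP[v <-]]; apply/asboolP.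
  by exists 0; rewrite linear0.
by exists (a *: u + v); rewrite linearP.
Qed.
HB.instance Definition _ := GRing.isSubmodClosed.Build k V range_pred range_submod.

Definition coker : Type := Quotient.quot range_pred.
HB.instance Definition _ := GRing.Zmodule.on coker.
HB.instance Definition _ := Quotient.on coker.

Lemma coker_piE (x y : V) : (\pi_coker x = \pi_coker y) <-> (x - y \in range_pred).
Proof. by rewrite Quotient.idealrBE; split=> [->|/eqP]. Qed.

Lemma coker_reprB (x : V) : repr (\pi_coker x) - x \in range_pred.
Proof. by apply/(coker_piE (repr (\pi_coker x)) x); rewrite reprK. Qed.

Definition coker_scale (a : k) (q : coker) : coker := \pi_coker (a *: repr q).

Lemma pi_coker_scale a x : coker_scale a (\pi_coker x) = \pi_coker (a *: x).
Proof. by apply/coker_piE; rewrite -scalerBr; apply: rpredZ; apply: coker_reprB. Qed.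

Fact coker_scaleA a b q : coker_scale a (coker_scale b q) = coker_scale (a * b) q.
Proof.
rewrite -[q]reprK (pi_coker_scale b (repr q)) (pi_coker_scale a (b *: repr q)).
by rewrite (pi_coker_scale (a * b) (repr q)) scalerA.
Qed.
Fact coker_scale1 : left_id 1 coker_scale.
Proof. by move=> q; rewrite -[q]reprK pi_coker_scale scale1r. Qed.
Fact coker_scaleDr : right_distributive coker_scale +%R.
Proof.
move=> a q r; rewrite -[q]reprK -[r]reprK -[_ + _]Quotient.pi_add.
rewrite (pi_coker_scale a (repr q + repr r)) (pi_coker_scale a (repr q)).
by rewrite (pi_coker_scale a (repr r)) scalerDr; apply: Quotient.pi_add.
Qed.
Fact coker_scaleDl q : {morph coker_scale^~ q : a b / a + b}.
Proof.
move=> a b; rewrite -[q]reprK (pi_coker_scale (a + b) (repr q)).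
rewrite (pi_coker_scale a (repr q)).
rewrite (pi_coker_scale b (repr q)) scalerDl.
exact: Quotient.pi_add.
Qed.
HB.instance Definition _ := GRing.Zmodule_isLmodule.Build k coker
  coker_scaleA coker_scale1 coker_scaleDr coker_scaleDl.

Fact coker_pi_linear : linear (fun x : V => \pi_coker x : coker).
Proof. by move=> a x y; rewrite [LHS]Quotient.pi_add -pi_coker_scale. Qed.
Definition coker_proj : {linear V -> coker} := lin_of coker_pi_linear.

Lemma coker_projK (q : coker) : coker_proj (repr q) = q.
Proof. exact: reprK. Qed.

Lemma coker_proj_eq0 x : coker_proj x = 0 <-> exists u, f u = x.
Proof.
rewrite -(linear0 coker_proj); split=> [/coker_piE|fx]; last apply/coker_piE.
  by rewrite subr0 => /asboolP.
by rewrite subr0; apply/asboolP.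
Qed.
End Cokernel.

(* The tensor product with [A] is right exact, since it commutes with cokernels; *)
(* flatness is only applied to the injection of [coker i] into [U].               *)
Section FlatExact.
Variables (k : comPzRingType) (A : lmodType k) (Aflat : flat A).
Variables (P V U : lmodType k) (i : {linear P -> V}) (h : {linear V -> U}).
Hypothesis ih : forall x, h x = 0 <-> exists y, i y = x.
Local Notation tens_id f := (tmap f (idfun : {linear A -> A})).
Local Notation pr := (coker_proj i).
Local Notation T := (coker (tens_id i)).

Lemma coker_proj_exact x y : pr x = pr y <-> h x = h y.
Proof.
by split=> E; apply/subr0_eq; rewrite -linearB; [apply/ih | apply/coker_proj_eq0];
   [apply/coker_proj_eq0 | apply/ih]; rewrite linearB E subrr.
Qed.

Fact coker_map_linear : linear (fun q : coker i => h (repr q)).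
Proof.
move=> a q r; rewrite -linearP; apply/coker_proj_exact.
by rewrite linearP !coker_projK.
Qed.
Definition coker_map : {linear coker i -> U} := lin_of coker_map_linear.

Lemma coker_mapE x : coker_map (pr x) = h x.
Proof. by apply/coker_proj_exact; rewrite coker_projK. Qed.

Lemma coker_map_inj : injective coker_map.
Proof. by move=> q r /coker_proj_exact; rewrite !coker_projK. Qed.

(** The difference x - y is some i z, so the two tensors differ by the image of z ⊗ a. This makes
    the maps below, defined on representatives, bilinear. *)
Lemma coker_ten (x y : V) (a : A) : pr x = pr y ->
  coker_proj (tens_id i) (x *t a) = coker_proj (tens_id i) (y *t a).
Proof.
move=> xy; apply/subr0_eq; rewrite -linearB; apply/coker_proj_eq0.
have [z zE] : exists z, i z = x - y.
  by apply/coker_proj_eq0; rewrite linearB xy subrr.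
by exists (z *t a); rewrite tmapE zE; apply: (linearB (lin_of (ten_l a))).
Qed.

Fact coker_ten_l (a : A) :
  linear (fun q : coker i => coker_proj (tens_id i) (repr q *t a)).
Proof.
move=> e q r; rewrite -linearP -ten_l; apply: coker_ten.
by rewrite linearP !coker_projK.
Qed.
Fact coker_ten_r (q : coker i) :
  linear (fun a : A => coker_proj (tens_id i) (repr q *t a)).
Proof. by move=> e a b; rewrite ten_r linearP. Qed.
Definition tens_coker : {linear tens (coker i) A -> T} :=
  tlift (Bilmap coker_ten_l coker_ten_r).

Lemma tens_cokerE u : tens_coker (tens_id pr u) = coker_proj _ u.
Proof.
elim/tens_ind: u => [x a|w w' hw hw']; last by rewrite !linD hw hw'.
by rewrite tmapE tliftE; apply: coker_ten; rewrite coker_projK.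
Qed.

(** The map h factors as [coker_map] after [pr]. Since [coker_map] is injective, flatness shows that
    [pr] ⊗ id already kills u; then [tens_coker] sends this zero to the class of u modulo the range
    of i ⊗ id. *)
Lemma flat_exact (u : tens V A) : tens_id h u = 0 -> exists w, tens_id i w = u.
Proof.
move=> hu; apply/coker_proj_eq0; rewrite -tens_cokerE.
suff -> : tens_id pr u = 0 by rewrite linear0.
apply: (Aflat coker_map_inj); rewrite linear0 -hu.
elim/tens_ind: u {hu} => [x a|w w' hw hw']; last by rewrite !linD hw hw'.
by rewrite !tmapE coker_mapE.
Qed.
End FlatExact.

(** * Functoriality and associativity of tensor products *)

Section TensorLemmas.
Variable k : comPzRingType.
Implicit Types M N P : lmodType k.

Lemma eq_tmap M N M' N' (f f' : {linear M -> M'}) (g g' : {linear N -> N'}) :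
  f =1 f' -> g =1 g' -> tmap f g =1 tmap f' g'.
Proof. by move=> ff' gg'; apply: tens_ext => x y; rewrite !tmapE ff' gg'. Qed.

Lemma tmap_comp M N M' N' M'' N'' (f : {linear M -> M'}) (g : {linear N -> N'})
    (f' : {linear M' -> M''}) (g' : {linear N' -> N''}) u :
  tmap f' g' (tmap f g u) = tmap (f' \o f) (g' \o g) u.
Proof.
elim/tens_ind: u => [x y|u v hu hv]; last by rewrite !linD hu hv.
by rewrite !tmapE.
Qed.

Lemma tmap_id M N (u : tens M N) : tmap idfun idfun u = u.
Proof.
elim/tens_ind: u => [x y|u v hu hv]; first by rewrite tmapE.
by rewrite linD hu hv.
Qed.

Lemma tassoc_tmapl M N P M' (f : {linear M -> M'}) (w : tens (tens M N) P) :
  tassoc _ _ _ (tmap (tmap f idfun) idfun w) = tmap f idfun (tassoc _ _ _ w).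
Proof.
elim/tens_ind: w => [u z|u v hu hv]; last by rewrite !linD hu hv.
rewrite tmapE; elim/tens_ind: u => [x y|u v hu hv].
  by rewrite tmapE !tassocE tmapE.
have D N' N'' (u1 u2 : tens N' N'') (p : P) : (u1 + u2) *t p = u1 *t p + u2 *t p.
  exact: (bilDl (ten_bil _ _)).
by rewrite linD !D !linD hu hv.
Qed.

(** The inverse of [tassoc], obtained by conjugating [tassoc] itself with swaps that reverse the
    order of the factors. *)
Definition tunassoc M N P (u : tens M (tens N P)) : tens (tens M N) P :=
  tmap (tswap N M) idfun
    (tswap _ _ (tassoc P N M (tmap (tswap N P) idfun (tswap _ _ u)))).

Lemma tunassocE M N P (x : M) (y : N) (z : P) :
  tunassoc (x *t (y *t z)) = x *t y *t z.
Proof.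
by rewrite /tunassoc tswapE tmapE tswapE tassocE tswapE tmapE tswapE.
Qed.

Lemma tunassocD M N P (u v : tens M (tens N P)) :
  tunassoc (u + v) = tunassoc u + tunassoc v.
Proof. by rewrite /tunassoc !linD. Qed.

Lemma tassocK M N P : cancel (tassoc M N P) (@tunassoc M N P).
Proof.
elim/tens_ind => [u z|u v hu hv]; last by rewrite linD tunassocD hu hv.
elim/tens_ind: u => [x y|u v hu hv]; first by rewrite tassocE tunassocE.
have -> : (u + v) *t z = u *t z + v *t z by exact: (bilDl (ten_bil _ _)).
by rewrite linD tunassocD hu hv.
Qed.

Lemma tunassocK M N P : cancel (@tunassoc M N P) (tassoc M N P).
Proof.
elim/tens_ind => [x u|u v hu hv]; last by rewrite tunassocD linD hu hv.
elim/tens_ind: u => [y z|u v hu hv]; first by rewrite tunassocE tassocE.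
have -> : x *t (u + v) = x *t u + x *t v by exact: (bilDr (ten_bil _ _)).
by rewrite tunassocD linD hu hv.
Qed.

Lemma tunassoc_tmap M N A B (f : {linear M -> N}) (u : tens M (tens A B)) :
  tmap (tmap f idfun) idfun (tunassoc u) = tunassoc (tmap f idfun u).
Proof.
apply: (can_inj (@tassocK _ _ _)).
by rewrite tassoc_tmapl (tunassocK u) (tunassocK (tmap f idfun u)).
Qed.

(** Up to reassociation, f ⊗ (A ⊗ B) is (f ⊗ A) ⊗ B, so the two flatness hypotheses apply in
    turn. *)
Lemma flat_tens A B : flat A -> flat B -> flat (tens A B : lmodType k).
Proof.
move=> Af Bf M N f f_inj u v uv; apply: (can_inj (@tunassocK _ _ _)).
apply: (Bf _ _ _ (Af _ _ _ f_inj)).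
by rewrite (tunassoc_tmap f u) (tunassoc_tmap f v) uv.
Qed.
End TensorLemmas.

(** * Kernels of equivariant maps as G-modules *)

Section Kernel.
Variables (k : comPzRingType) (V U : lmodType k) (h : {linear V -> U}).

Definition ker_pred : {pred V} := fun x => h x == 0.
Fact ker_submod : GRing.submod_closed ker_pred.
Proof.
split=> [|a x y /eqP hx /eqP hy]; apply/eqP; first exact: linear0.
by rewrite linearP hx hy scaler0 addr0.
Qed.
HB.instance Definition _ := GRing.isSubmodClosed.Build k V ker_pred ker_submod.

Record ker := Ker { ker_val : V; _ : ker_val \in ker_pred }.
HB.instance Definition _ := [isSub for ker_val].
HB.instance Definition _ := [Choice of ker by <:].
HB.instance Definition _ := [SubChoice_isSubLmodule of ker by <:].

Fact ker_val_linear : linear ker_val.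
Proof. by []. Qed.
Definition ker_incl : {linear ker -> V} := lin_of ker_val_linear.

Lemma ker_inclP x : h x = 0 <-> exists y, ker_incl y = x.
Proof.
split=> [hx|[[y /eqP hy] <-] //].
by have kx : x \in ker_pred by [apply/eqP]; exists (Ker kx).
Qed.

Lemma ker_incl_inj : injective ker_incl.
Proof. exact: val_inj. Qed.
End Kernel.

Section KernelModule.
Variables (k : comPzRingType) (G : affGroupScheme k).
Local Notation kG := (coord_ring G).
Hypothesis Gflat : flat kG.
Variables (M N : gmodule G) (h : {linear M -> N}).
Hypothesis hG : gmorph h.
Local Notation i := (ker_incl h).
Local Notation ti := (tmap i (idfun : {linear kG -> kG})).

Lemma ker_coact_exists (x : ker h) : exists w, ti w = coact M (i x).
Proof.
apply: (flat_exact Gflat (@ker_inclP _ _ _ h)).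
have hx : h (i x) = 0 by apply/ker_inclP; exists x.
by rewrite hG hx linear0.
Qed.

Definition ker_coact_fun x := sval (cid (ker_coact_exists x)).
Lemma ker_coactE x : ti (ker_coact_fun x) = coact M (i x).
Proof. exact: (svalP (cid (ker_coact_exists x))). Qed.

Fact ker_coact_linear : linear ker_coact_fun.
Proof.
move=> a x y; apply: (Gflat (@ker_incl_inj _ _ _ h)).
by rewrite [RHS]linearP !ker_coactE !linearP.
Qed.
Definition ker_coact : {linear ker h -> tens (ker h) kG} := lin_of ker_coact_linear.

(** Coassociativity is inherited from M: both sides are compared after embedding in M ⊗ (k[G] ⊗
    k[G]), which is legitimate because k[G] ⊗ k[G] is flat. *)
Fact ker_coactA x : tassoc _ _ _ (tmap ker_coact idfun (ker_coact x)) =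
  tmap idfun (comul kG) (ker_coact x).
Proof.
apply: (flat_tens Gflat Gflat (@ker_incl_inj _ _ _ h)).
rewrite -tassoc_tmapl !tmap_comp.
have -> : tmap (i \o idfun) (idfun \o comul kG) (ker_coact x) =
    tmap idfun (comul kG) (ti (ker_coact x)).
  by rewrite tmap_comp; apply: eq_tmap.
rewrite ker_coactE -coactA -ker_coactE tmap_comp; congr (tassoc _ _ _ _).
by apply: eq_tmap => // y; apply: ker_coactE.
Qed.

Fact ker_coact1 x : tcontract _ (counit kG) (ker_coact x) = x.
Proof.
apply: (@ker_incl_inj _ _ _ h); rewrite -[RHS](coact1 (i x)) -ker_coactE.
rewrite -[ker_coact_fun x]/(ker_coact x).
elim/tens_ind: (ker_coact x) => [y a|u v hu hv]; last first.
  by rewrite !linD hu hv.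
by rewrite tmapE !tcontractE linZ.
Qed.
Definition gker : gmodule G := GModule ker_coactA ker_coact1.

Lemma ker_incl_gmorph : gmorph (M := gker) i.
Proof. exact: ker_coactE. Qed.
End KernelModule.

(** * Direct sums of G-modules *)

Section ProductModule.
Variables (k : comPzRingType) (G : affGroupScheme k) (M N : gmodule G).
Local Notation kG := (coord_ring G).
Local Notation MN := (M * N)%type.

Fact prod_inl_linear : linear (fun x : M => (x, 0) : MN).
Proof. by move=> a x y; congr (_, _); rewrite /= scaler0 addr0. Qed.
Fact prod_inr_linear : linear (fun y : N => (0, y) : MN).
Proof. by move=> a x y; congr (_, _); rewrite /= scaler0 addr0. Qed.
Fact prod_fst_linear : linear (fun p : MN => p.1).
Proof. by []. Qed.
Fact prod_snd_linear : linear (fun p : MN => p.2).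
Proof. by []. Qed.
Definition prod_inl : {linear M -> MN} := lin_of prod_inl_linear.
Definition prod_inr : {linear N -> MN} := lin_of prod_inr_linear.
Definition prod_fst : {linear MN -> M} := lin_of prod_fst_linear.
Definition prod_snd : {linear MN -> N} := lin_of prod_snd_linear.

Definition prod_coact_fun (p : MN) : tens MN kG :=
  tmap prod_inl idfun (coact M p.1) + tmap prod_inr idfun (coact N p.2).
Fact prod_coact_linear : linear prod_coact_fun.
Proof.
move=> a p q; rewrite /prod_coact_fun.
rewrite (linearP (coact M) a p.1 q.1) (linearP (coact N) a p.2 q.2).
by rewrite !linearP scalerDr addrACA.
Qed.
Definition prod_coact : {linear MN -> tens MN kG} := lin_of prod_coact_linear.

Lemma prod_coact_inl x : prod_coact (prod_inl x) = tmap prod_inl idfun (coact M x).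
Proof. by rewrite -[LHS]/(_ + _) (linear0 (coact N)) linear0 addr0. Qed.
Lemma prod_coact_inr y : prod_coact (prod_inr y) = tmap prod_inr idfun (coact N y).
Proof. by rewrite -[LHS]/(_ + _) (linear0 (coact M)) linear0 add0r. Qed.
Lemma prod_inlr (p : MN) : p = prod_inl p.1 + prod_inr p.2.
Proof. by case: p => x y; congr (_, _); rewrite /= ?addr0 ?add0r. Qed.

Fact prod_coactA p : tassoc _ _ _ (tmap prod_coact idfun (prod_coact p)) =
  tmap idfun (comul kG) (prod_coact p).
Proof.
have H (L : gmodule G) (i : {linear L -> MN}) x :
    (forall z, prod_coact (i z) = tmap i idfun (coact L z)) ->
    tassoc _ _ _ (tmap prod_coact idfun (prod_coact (i x))) =
    tmap idfun (comul kG) (prod_coact (i x)).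
  move=> iG; rewrite iG tmap_comp.
  transitivity (tmap i idfun (tmap idfun (comul kG) (coact L x))); last first.
    by rewrite !tmap_comp; apply: eq_tmap.
  rewrite -coactA -tassoc_tmapl tmap_comp; congr (tassoc _ _ _ _).
  exact: eq_tmap.
rewrite [p]prod_inlr (linD prod_coact).
rewrite (linD (tmap prod_coact _)) (linD (tassoc _ _ _)) (linD (tmap idfun _)).
by rewrite (H M prod_inl p.1 prod_coact_inl) (H N prod_inr p.2 prod_coact_inr).
Qed.

Fact prod_coact1 p : tcontract _ (counit kG) (prod_coact p) = p.
Proof.
have H (L : gmodule G) (i : {linear L -> MN}) (u : tens L kG) :
    tcontract _ (counit kG) (tmap i idfun u) = i (tcontract _ (counit kG) u).
  elim/tens_ind: u => [x a|u v hu hv]; last by rewrite !linD hu hv.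
  by rewrite tmapE !tcontractE linZ.
by rewrite [RHS]prod_inlr [LHS]linD (H M) (H N) !coact1.
Qed.
Definition gprod : gmodule G := GModule prod_coactA prod_coact1.

Lemma prod_fst_gmorph : gmorph (M := gprod) (N := M) prod_fst.
Proof.
move=> p; rewrite [LHS]linD !tmap_comp -[RHS]addr0; congr (_ + _).
  by rewrite -[RHS]tmap_id; apply: eq_tmap.
elim/tens_ind: (coact N _) => [y a|u v hu hv]; last by rewrite linD hu hv addr0.
by rewrite tmapE; apply: (linear0 (lin_of (ten_l a))).
Qed.

Lemma prod_snd_gmorph : gmorph (M := gprod) (N := N) prod_snd.
Proof.
move=> p; rewrite [LHS]linD !tmap_comp -[RHS]add0r; congr (_ + _).
  elim/tens_ind: (coact M _) => [y a|u v hu hv]; last by rewrite linD hu hv addr0.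
  by rewrite tmapE; apply: (linear0 (lin_of (ten_l a))).
by rewrite -[RHS]tmap_id; apply: eq_tmap.
Qed.
End ProductModule.

(** * Functoriality of symmetric powers, and S^d k as a free module of rank one *)

Section SymmetricPowers.
Variable k : comPzRingType.

Lemma smap_smul (M N : lmodType k) (f : {linear M -> N}) d x u :
  smap d.+1 f (smul M d x u) = smul N d (f x) (smap d f u).
Proof.
elim/Sym_ind: u => [|a t u hu]; first by rewrite -(scale0r 0) !(bilZr, linZ) !scale0r.
rewrite !(bilDr, linD, bilZr, linZ) hu smulE !smapE smulE.
by congr (_ *: mon _ + _); apply: val_inj.
Qed.

Fact symprod_sml d :
  symmetric_multilinear (fun t : d.-tuple k^o => \prod_(x <- t) x : k^o).
Proof.
split=> [t t' tt'|t i a x y]; first exact: perm_big.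
have E z : \prod_(w <- tset t i z) w = z * \prod_(j < d | j != i) tnth t j :> k.
  rewrite big_tuple (bigD1 i) //= tnth_mktuple eqxx; congr (_ * _).
  by apply: eq_bigr => j /negPf ji; rewrite tnth_mktuple ji.
by rewrite !E mulrDl -[in LHS]mulrA.
Qed.
Definition symprod d : {linear Sym k^o d -> k^o} := slift (@symprod_sml d).

Definition symone d : Sym k^o d := mon [tuple of nseq d (1 : k^o)].

Lemma symprodE d (t : d.-tuple k^o) : symprod d (mon t) = \prod_(x <- t) x.
Proof. exact: sliftE. Qed.

Lemma symprod_one d : symprod d (symone d) = 1.
Proof. by rewrite symprodE /= big_nseq; elim: d => //= d ->; apply: mul1r. Qed.

(** Scalars can be pulled out of each factor of a monomial, so [symone] generates S^d k and
    [symprod] is the coordinate with respect to it. *)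
Lemma symprodK d (u : Sym k^o d) : u = (symprod d u : k) *: symone d.
Proof.
elim/Sym_ind: u => [|a t u hu]; first by rewrite linear0 scale0r.
rewrite linD linZ scalerDl -hu -scalerA; congr (_ *: _ + _); rewrite symprodE {u hu}.
elim: d t => [|d IH] t.
  by rewrite tuple0 big_nil scale1r; congr mon; apply: val_inj.
case/tupleP: t => x t; rewrite -smulE [mon t]IH big_cons bilZr.
have -> : smul k^o d x (symone d) = (x : k) *: symone d.+1.
  rewrite -{1}[x]mulr1 -[_ * 1]/((x : k) *: (1 : k^o)) bilZl smulE.
  by congr (_ *: mon _); apply: val_inj.
by rewrite scalerA mulrC.
Qed.
End SymmetricPowers.

(** * Equivariant maps, and invariants obtained from power reductivity *)

Section Equivariance.
Variables (k : comPzRingType) (G : affGroupScheme k).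
Local Notation kG := (coord_ring G).
Implicit Types M N P : gmodule G.

Lemma gmorph_comp M N P (f : {linear M -> N}) (g : {linear N -> P}) :
  gmorph f -> gmorph g -> gmorph (g \o f).
Proof.
move=> fG gG x; rewrite -[RHS]gG -fG tmap_comp; exact: eq_tmap.
Qed.

Lemma gmorph_invariant M N (f : {linear M -> N}) x :
  gmorph f -> invariant x -> invariant (f x).
Proof. by move=> fG xG; rewrite /invariant -fG xG tmapE. Qed.

Lemma smap_gmorph M N (f : {linear M -> N}) d : gmorph f ->
  gmorph (M := gsym M d) (N := gsym N d) (smap d f).
Proof.
move=> fG; elim/Sym_ind => [|a t u hu]; first by rewrite !linear0.
rewrite 4!linD 4!linZ hu; congr (_ *: _ + _).
rewrite -[coact (gsym M d) _]/(sym_coact M d _).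
rewrite -[coact (gsym N d) _]/(sym_coact N d _) {u hu}.
elim: d t => [|d IH] t.
  rewrite tuple0 sym_coact_nil tmapE smapE.
  have -> : [tuple of map f [tuple]] = [tuple] by apply: val_inj.
  by rewrite sym_coact_nil.
case/tupleP: t => x t; rewrite -smulE sym_coact_cons smap_smul sym_coact_cons -fG -IH.
elim/tens_ind: (coact M x) => [y a'|u u' hu hu']; last by rewrite !(bilDl, linD) hu hu'.
elim/tens_ind: (sym_coact M d _) => [z c|u u' hu hu']; last first.
  by rewrite !(bilDr, linD) hu hu'.
by rewrite tmulE !tmapE tmulE smap_smul.
Qed.

Lemma mon_invariant M d (t : d.-tuple M) : (forall x, x \in (t : seq M) -> invariant x) ->
  invariant (M := gsym M d) (mon t).
Proof.
rewrite /invariant -[coact (gsym M d) _]/(sym_coact M d _).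
elim: d t => [|d IH] t; first by rewrite tuple0 sym_coact_nil.
case/tupleP: t => x t tG; rewrite -smulE sym_coact_cons tG ?mem_head //.
by rewrite IH => [|y yt]; rewrite ?tmulE /= ?mulr1 // tG // inE yt orbT.
Qed.

(** The stable complement C of the kernel is a copy of S^d k, hence generated by its element y above
    [symone]. As C is stable, the coaction sends y to y ⊗ a for some a, and equivariance compares a
    with the trivial coaction on S^d k, giving a = 1. *)
Lemma power_reductive_invariant : power_reductive G ->
  forall (M : gmodule G) (phi : {linear M -> k^o}),
  gmorph (N := gtriv G k^o) phi -> (forall y, exists x, phi x = y) ->
  exists2 d, (0 < d)%N & exists2 f : Sym M d,
    invariant (M := gsym M d) f & symprod k d (smap d phi f) = 1.
Proof.
move=> pr M phi phiG phi_surj.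
have [d d_gt0 [surj [C [Csub Cst Cinj Cdec]]]] := pr M phi phiG phi_surj.
exists d => //; have [x0 x0E] := surj (symone k d).
have [y [z [yC z0 x0yz]]] := Cdec x0.
have yE : smap d phi y = symone k d by rewrite -x0E x0yz linD z0 addr0.
exists y; last by rewrite yE symprod_one.
pose L : {linear Sym M d -> k^o} := symprod k d \o smap d phi.
(* The difference lies in C and is killed by [smap d phi], hence vanishes. *)
have CL c : c \in C -> c = (L c : k) *: y.
  move=> cC; apply/subr0_eq/Cinj.
    by rewrite addrC -scaleNr; apply: Csub.2.
  rewrite linearB linZ yE; apply/subr0_eq; rewrite subr0.
  by rewrite -[X in _ - X]symprodK subrr.
have [s [/allP sC yc]] := Cst _ yC.
have Dsum : coact (gsym M d) y = y *t (\sum_(p <- s) (L p.1 : k) *: p.2 : kG).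
  rewrite yc -[RHS]/(lin_of (ten_r y) _) linear_sum big_seq [RHS]big_seq.
  apply: eq_bigr => p ps; rewrite {1}(CL _ (sC _ ps)) linZ.
  exact: (bilZl (ten_bil _ _)).
rewrite /invariant Dsum; congr (_ *t _).
(* [T] is L ⊗ id. It recovers a from the coaction of y; since L factors through S^d k, it can also
   be computed on the invariant [symone]. *)
pose T (u : tens (Sym M d) kG) := tcontract kG L (tswap _ _ u).
have -> : \sum_(p <- s) (L p.1 : k) *: p.2 = T (coact (gsym M d) y).
  rewrite yc /T (linear_sum (tswap _ _)) (linear_sum (tcontract _ _)).
  apply: eq_bigr => p _.
  by rewrite tswapE tcontractE.
have TE u : T u = tcontract kG (symprod k d) (tswap _ _ (tmap (smap d phi) idfun u)).
  elim/tens_ind: u => [x a|u v hu hv]; last by rewrite /T !linD in hu hv *; rewrite hu hv.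
  by rewrite /T tmapE !tswapE !tcontractE.
have oneG : invariant (M := gsym (gtriv G k^o) d) (symone k d) by apply: mon_invariant.
by rewrite TE (smap_gmorph phiG) yE oneG tswapE tcontractE symprod_one scale1r.
Qed.
End Equivariance.

(** * Evaluation at a vector of F ⊗ M *)

Section Evaluation.
Variables (k : comPzRingType) (G : affGroupScheme k).
Local Notation kG := (coord_ring G).

Lemma antipode1 : antipode kG 1 = 1.
Proof.
have := antipode_l (h := kG) 1.
by rewrite comul1 tmapE tliftE counit1 scale1r /= mulr1.
Qed.

Variables (M : gmodule G) (Mfg : fg_projective M) (F : comAlg k).
Definition eval_lin (v : tens F M) : {linear dual M -> F} :=
  lin_of (eval_form_linear v).

Lemma eval_linD (u v : tens F M) f : eval_lin (u + v) f = eval_lin u f + eval_lin v f.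
Proof. exact: linD. Qed.

Lemma eval_linE (c : F) (x : M) (f : dual M) : eval_lin (c *t x) f = (f x : k) *: c.
Proof. exact: tcontractE. Qed.

(** With a dual basis (e_i, c_i) of M, v is the sum of the c_i(v) ⊗ e_i, so it is zero as soon as
    all forms vanish on it. *)
Lemma eval_form_neq0 (v : tens F M) : v != 0 -> exists f, eval_form v f != 0.
Proof.
apply: contra_neqP => h; have [n [e [c ec]]] := fg_dual_basis Mfg.
have E u : u = \sum_i eval_form u (c i) *t e i.
  elim/tens_ind: u => [a x|u w hu hw].
    rewrite {1}(ec x) -[LHS]/(lin_of (ten_r a) _) linear_sum.
    apply: eq_bigr => i _; rewrite linZ.
    have -> : eval_form (a *t x) (c i) = (c i x : k) *: a by exact: tcontractE.
    by symmetry; exact: (bilZl (ten_bil _ _)).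
  rewrite {1}hu {1}hw -big_split; apply: eq_bigr => i _.
  have -> : eval_form (u + w) (c i) = eval_form u (c i) + eval_form w (c i).
    exact: linD.
  symmetry; exact: (bilDl (ten_bil _ _)).
rewrite [v]E big1 // => i _; have [->|ne] := eqVneq (eval_form v (c i)) 0.
  exact: (linear0 (lin_of (ten_l (e i)))).
by case: h; exists (c i).
Qed.

(* In Sweedler notation: [f_0(v) *t f_1 = f(v_0) *t S(v_1)]. *)
Lemma eval_dual_coact f (v : tens F M) :
  tmap (eval_lin v) idfun (coact (gdual Mfg) f) =
  tmap (tcontract F (dual_lin f)) (antipode kG) (coact (gtens (gtriv G F) M) v).
Proof.
elim/tens_ind: v => [c x|u v hu hv]; last first.
  rewrite linD [RHS]linD -hu -hv.
  elim/tens_ind: (coact (gdual Mfg) f) => [g a|w w' hw hw'].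
    by rewrite !tmapE eval_linD; exact: (bilDl (ten_bil _ _)).
  by rewrite 3!linD hw hw' addrACA.
have evx w : tmap (eval_lin (c *t x)) idfun w = c *t evalx kG x w.
  elim/tens_ind: w => [g a|w w' hw hw'].
    rewrite tmapE evalxE eval_linE -[LHS]/(ten_bil _ _ _ _).
    by rewrite bilZl -bilZr.
  by rewrite 2!linD hw hw'; symmetry; exact: (bilDr (ten_bil _ _)).
rewrite evx [evalx _ _ _]dual_coactP.
rewrite -[coact (gtens (gtriv G F) M) _]/(gtens_coact _ _ (ten_bil (gtriv G F) M c x)).
rewrite gtens_coactE.
elim/tens_ind: (coact M x) => [y a|w w' hw hw'].
  rewrite contraE tmulE -[alg_mul kG 1 a]/(1 * a) mul1r tmapE.
  rewrite [tcontract _ _ _]tcontractE -[LHS]/(ten_bil _ _ _ _).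
  by rewrite bilZr -bilZl.
by rewrite bilDr 2!linD -hw -hw'; exact: (bilDr (ten_bil _ _)).
Qed.

(** When v is invariant its coaction is v ⊗ 1, so the formula above becomes f(v) ⊗ S(1) = f(v) ⊗ 1,
    the trivial coaction of f(v). *)
Lemma eval_lin_gmorph (v : tens F M) : invariant (M := gtens (gtriv G F) M) v ->
  gmorph (M := gdual Mfg) (N := gtriv G F) (eval_lin v).
Proof. by move=> vG f; rewrite eval_dual_coact vG tmapE antipode1. Qed.
End Evaluation.

(** * The fibre product over F, and geometric reductivity *)

Section EvaluationGraph.
Variables (k : comPzRingType) (G : affGroupScheme k).
Local Notation kG := (coord_ring G).
Variables (L : gmodule G) (F : comAlg k) (ev : {linear L -> F}) (b : F).
Hypothesis evG : gmorph (N := gtriv G F) ev.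
Local Notation Q := (gprod L (gtriv G k^o)).

Fact graph_eq_linear : linear (fun p : Q => ev p.1 - (p.2 : k) *: b).
Proof.
move=> a p q; rewrite -[(a *: p + q).1]/(a *: p.1 + q.1) linearP.
rewrite -[(a *: p + q).2]/(a * (p.2 : k) + q.2 : k) scalerDl -scalerA opprD.
by rewrite scalerBr addrACA.
Qed.
(** Its kernel is the fibre product of [ev] with the map c ↦ c b from k to F. *)
Definition graph_eq : {linear Q -> F} := lin_of graph_eq_linear.

Lemma graph_eq_gmorph : gmorph (M := Q) (N := gtriv G F) graph_eq.
Proof.
move=> p; rewrite [coact Q p]/= /prod_coact_fun linD !tmap_comp.
transitivity (tmap ev idfun (coact L p.1) - ((p.2 : k) *: b) *t (1 : kG)).
  congr (_ + _).
    by apply: eq_tmap => // x /=; rewrite scale0r subr0.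
  by rewrite tmapE /= linear0 sub0r; exact: (linearN (lin_of (ten_l (1 : kG)))).
rewrite evG; symmetry; exact: (linearB (lin_of (ten_l (1 : kG)))).
Qed.
End EvaluationGraph.

(** Here [g] stands for the extension of [ev] to S^d L that is multiplicative on monomials;
    [sym_eval] is the instance used later. *)
Lemma power_reductive_eval (k : comPzRingType) (G : affGroupScheme k)
    (Gflat : flat (coord_ring G)) : power_reductive G ->
  forall (L : gmodule G) (F : comAlg k) (ev : {linear L -> F}),
  gmorph (N := gtriv G F) ev -> forall x0,
  exists2 d, (0 < d)%N & exists2 f : Sym L d,
    invariant (M := gsym L d) f &
    forall g : {linear Sym L d -> F},
      (forall t : d.-tuple L, g (mon t) = \prod_(x <- t) ev x) -> g f = ev x0 ^+ d.
Proof.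
move=> pr L F ev evG x0; set b := ev x0.
pose i := ker_incl (graph_eq ev b).
pose K := gker Gflat (graph_eq_gmorph b evG).
have iG : gmorph (M := K) i by apply: ker_incl_gmorph.
have fstG := gmorph_comp iG (@prod_fst_gmorph _ _ L (gtriv G k^o)).
have sndG := gmorph_comp iG (@prod_snd_gmorph _ _ L (gtriv G k^o)).
set phi := (X in gmorph X) in sndG; set psi := (X in gmorph X) in fstG.
have evE x : ev (psi x) = (phi x : k) *: b.
  by apply/subr0_eq/(ker_inclP (graph_eq ev b) (i x)); exists x.
have phi_surj y : exists x, phi x = y.
  (* Multiples of (x0, 1) lie in the fibre product because b = ev(x0); this is where surjectivity
     onto k comes from. *)
  have /ker_inclP[x ix] : graph_eq ev b ((y : k) *: x0, y) = 0.
    by rewrite /= linZ subrr.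
  by exists x; apply: (congr1 snd ix).
have [d d_gt0 [f fG f1]] := power_reductive_invariant pr sndG phi_surj.
exists d => //; exists (smap d psi f).
  exact: (gmorph_invariant (smap_gmorph fstG) fG).
move=> g gE.
(* On K, [ev] after [psi] is b times [phi], so on a product of d elements each factor contributes
   one b. The chosen f has coordinate 1. *)
suff H u : g (smap d psi u) = (symprod k d (smap d phi u) : k) *: b ^+ d.
  by rewrite H f1 scale1r.
elim/Sym_ind: u => [|a t u hu]; first by rewrite !linear0 scale0r.
rewrite 2!linD 2!linZ hu [in RHS]linD [in RHS]linZ [in RHS]linD [in RHS]linZ.
rewrite scalerDl -scalerA; congr (_ *: _ + _).
rewrite !smapE gE symprodE !big_map {u hu}.
elim: d t {d_gt0 f fG f1 g gE} => [|d IH] t.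
  by rewrite tuple0 !big_nil scale1r.
case/tupleP: t => x t; rewrite !big_cons IH evE exprS.
by rewrite -alg_scaleAl -alg_scaleAr scalerA.
Qed.

Lemma power_reductive_geom_ring (k : comPzRingType) (G : affGroupScheme k)
    (Gflat : flat (coord_ring G)) : power_reductive G -> geom_reductive_ring G.
Proof.
move=> pr M Mfree F [F1 Finv] v vG v0.
have [f0 f0v] := eval_form_neq0 (fg_free_projective Mfree) v0.
have [d d_gt0 [f fG fE]] := power_reductive_eval Gflat pr
  (eval_lin_gmorph (Mfg := fg_free_projective Mfree) vG) f0.
exists d => //; exists f => //; rewrite fE; last by move=> t; rewrite sliftE.
have [c bc] := Finv _ f0v.
apply: contra_neq F1 => bd.
(* With b c = 1, vanishing of b^d would give 1 = b^d c^d = 0 in F. *)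
by rewrite -(expr1n _ d) -bc exprMn [X in X * _]bd mul0r.
Qed.

Definition base_alg (k : comPzRingType) : comAlg k := ComAlg (idfun : {rmorphism k -> k}).

Lemma geom_reductive_ring_field (k : comPzRingType) (G : affGroupScheme k) :
  is_field k -> geom_reductive_ring G -> geom_reductive_field G.
Proof.
move=> kF gr M Mfin phi phiG phi_inj.
pose v : tens (base_alg k) M := (1 : base_alg k) *t phi 1.
have vG : invariant (M := gtens (gtriv G (base_alg k)) M) v.
  rewrite /invariant -[coact (gtens _ M) _]
    /(gtens_coact _ _ (ten_bil (gtriv G (base_alg k)) M 1 (phi 1))).
  rewrite gtens_coactE.
  rewrite -phiG -[coact (gtriv G k^o) _]/((1 : k^o) *t (1 : coord_ring G)) tmapE.
  rewrite -[coact (gtriv G _) _]/((1 : base_alg k) *t (1 : coord_ring G)) tmulE.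
  congr (_ *t _); exact: mul1r.
have v0 : v != 0.
  (* Contracting the factor F = k recovers phi(1) from v, so v = 0 would give phi(1) = phi(0),
     against injectivity. *)
  have sl : linear (fun c : base_alg k => c : k^o) by [].
  have : tcontract M (lin_of sl) (tswap _ _ v) = phi 1.
    by rewrite tswapE tcontractE scale1r.
  apply: contraPneq => ->; rewrite 2!linear0 => /esym; rewrite -(linear0 phi).
  by move=> /phi_inj/eqP; rewrite (negPf kF.1).
have [d d_gt0 [f fG fv]] := gr M Mfin (base_alg k) kF v vG v0.
exists d => //; exists f => //.
apply: contra_neq fv => f0.
(* Evaluation at 1 ⊗ phi(1) is restriction along [phi] followed by evaluation at 1 ⊗ 1, so it
   vanishes on f if the restriction of f does. *)
suff -> : sym_eval v d f =
    sym_eval ((1 : base_alg k) *t (1 : k^o)) d (smap d (dual_map phi) f).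
  by rewrite f0 linear0.
elim/Sym_ind: f {fG f0} => [|a t u hu]; first by rewrite !linear0.
rewrite 3!linD 3!linZ hu smapE !sliftE big_map; congr (_ *: _ + _).
by apply: eq_bigr => g _; rewrite /v /eval_form !tcontractE.
Qed.

Theorem lemma12 (k : comPzRingType) (G : affGroupScheme k)
    (Gflat : flat (coord_ring G)) :
  power_reductive G -> geometrically_reductive G.
Proof.
move=> pr; have gr := power_reductive_geom_ring Gflat pr.
by split=> // kF; apply: geom_reductive_ring_field.
Qed.
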